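(* Let $L$ be a finite-dimensional solvable restricted Lie algebra over a field $\mathbb{F}$ of prime characteristic. Then every non-trivial split chief factor of $L$ is a direct summand of the second Loewy layer $\operatorname{Jac}(u(L))P_L(\mathbb{F})/\operatorname{Jac}(u(L))^2P_L(\mathbb{F})$ of the projective cover $P_L(\mathbb{F})$ of the trivial irreducible $L$-module. In particular, every split chief factor of $L$ is a composition factor of $P_L(\mathbb{F})$.
   Context: For a finite-dimensional restricted Lie algebra $L$ over $\mathbb{F}$, $u(L)$ denotes its restricted universal enveloping algebra, a finite-dimensional unital associative algebra whose modules are exactly the restricted $L$-modules. $\operatorname{Jac}(A)$ denotes the Jacobson radical of a finite-dimensional associative algebra $A$. $P_L(\mathbb{F}):=P_{u(L)}(\mathbb{F})$ denotes the projective cover of the trivial irreducible $L$-module $\mathbb{F}$ as a $u(L)$-module. A chief series of a finite-dimensional Lie algebra $L$ is an ascending chain $0=L_0\subset L_1\subset\cdots\subset L_n=L$ of (ordinary) ideals of $L$ such that $L_j/L_{j-1}$ is a minimal (non-zero) ideal of $L/L_{j-1}$ for every $1\le j\le n$; each $L_j/L_{j-1}$ is called a chief factor, and it is an irreducible $L$-module via the adjoint action (a restricted one if $L$ is restricted). Every chief factor of a solvable Lie algebra is abelian. A chief factor $L_j/L_{j-1}$ is split if the exact sequence $0\to L_j/L_{j-1}\to L/L_{j-1}\to L/L_j\to 0$ splits in the category of (ordinary) Lie algebras. It is non-trivial if it is not isomorphic to the trivial irreducible module $\mathbb{F}$ as an $L$-module. Being a direct summand or composition factor is understood up to isomorphism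 of $L$-modules. *)

(* Defs.v *)
From HB Require Import structures.
From mathcomp Require Import all_boot all_order all_algebra all_field.
From mathcomp Require Import ring_quotient generic_quotient.
From mathcomp Require Import boolp.

Set Implicit Arguments.
Unset Strict Implicit.
Unset Printing Implicit Defensive.

Import GRing.Theory.
Import ring_quotient.Quotient.

Local Open Scope ring_scope.
Local Open Scope quotient_scope.

Reserved Notation "[[ x , y ]]" (at level 0, format "[[ x ,  y ]]").

Section ModuleConstructions.
Variables (R : pzRingType) (V : lmodType R).

(* Here and below, submodules are Boolean predicates; by the classical axioms *)
(* of boolp, every Prop-valued submodule is one of these.                     *)
Definition lspan (X : V -> Prop) : {pred V} :=
  fun v =>
    `[< forall S : submodClosed V, (forall w, X w -> w \in S) -> v \in S >].

Lemma lspan_closed X : GRing.submod_closed (lspan X).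
Proof.
split; first by apply/asboolP => S _; exact: rpred0.
move=> a u v /asboolP uX /asboolP vX; apply/asboolP => S XS.
by rewrite rpredD ?rpredZ ?uX ?vX.
Qed.

HB.instance Definition _ X :=
  GRing.isSubmodClosed.Build R V (lspan X) (lspan_closed X).

Definition submod (S : submodClosed V) : Type := {x : V | x \in S}.
HB.instance Definition _ (S : submodClosed V) := SubChoice.on (submod S).

Lemma submodule_closed (S : submodClosed V) : GRing.submod_closed S.
Proof.
by split=> [|a u v uS vS]; [exact: rpred0 | rewrite rpredD ?rpredZ].
Qed.

HB.instance Definition _ (S : submodClosed V) :=
  GRing.SubChoice_isSubLmodule.Build R V (fun x => x \in S) (submod S)
    (submodule_closed S).

Definition simple_module : Prop :=
  (exists v : V, v != 0) /\
  forall S : submodClosed V, S =i pred1 0 \/ S =i predT.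

(* GRing.SubmodClosed does not record closure under opposite. *)
Definition zmod_pred (S : submodClosed V) : {pred V} := S.
HB.instance Definition _ (S : submodClosed V) :=
  GRing.isSubmodClosed.Build R V (zmod_pred S) (submodule_closed S).

Definition quotmod (S : submodClosed V) : Type := {quot (zmod_pred S)}.

Variable S : submodClosed V.
Local Notation Q := (quotmod S).

HB.instance Definition _ := GRing.Zmodule.on Q.
HB.instance Definition _ := EqQuotient.on Q.

Lemma quotmod_eqP (x y : V) : reflect (x = y %[mod Q]) (x - y \in S).
Proof. by rewrite [_ \in S](idealrBE (zmod_pred S)); exact: eqP. Qed.

Lemma quotmod_piB : zmod_morphism (\pi_Q : V -> Q).
Proof. by move=> x y; rewrite [LHS](raddfB (\pi_({quot (zmod_pred S)}))). Qed.

HB.instance Definition _ := GRing.isZmodMorphism.Build V Q \pi_Q quotmod_piB.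

Definition quotmod_scale (a : R) (q : Q) : Q := \pi_Q (a *: repr q).

Lemma quotmod_scaleE a x : quotmod_scale a (\pi_Q x) = \pi_Q (a *: x).
Proof.
rewrite /quotmod_scale; apply/quotmod_eqP; rewrite -scalerBr rpredZ //.
by apply/quotmod_eqP; rewrite reprK.
Qed.

Lemma quotmod_scalerA a b q :
  quotmod_scale a (quotmod_scale b q) = quotmod_scale (a * b) q.
Proof. by rewrite -[q]reprK [in LHS](quotmod_scaleE b) !quotmod_scaleE scalerA. Qed.

Lemma quotmod_scale1r : left_id 1 quotmod_scale.
Proof. by move=> q; rewrite -[q]reprK quotmod_scaleE scale1r. Qed.

Lemma quotmod_scalerDr : right_distributive quotmod_scale +%R.
Proof.
move=> a q r; rewrite -[q]reprK -[r]reprK -raddfD !quotmod_scaleE -raddfD.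
by rewrite scalerDr.
Qed.

Lemma quotmod_scalerDl q : {morph quotmod_scale^~ q : a b / a + b}.
Proof.
by move=> a b; rewrite -[q]reprK !quotmod_scaleE -raddfD scalerDl.
Qed.

HB.instance Definition _ := GRing.Zmodule_isLmodule.Build R Q
  quotmod_scalerA quotmod_scale1r quotmod_scalerDr quotmod_scalerDl.

Lemma quotmod_piZ : scalable (\pi_Q : V -> Q).
Proof. by move=> a x; rewrite -quotmod_scaleE. Qed.

HB.instance Definition _ := GRing.isScalable.Build R V Q *:%R \pi_Q quotmod_piZ.

(* The image of A in V / S: equal to A / S when S is contained in A. *)
Definition quot_image (A : submodClosed V) : {pred Q} :=
  fun q => `[< exists2 x, x \in A & q = \pi_Q x >].

Lemma quot_image_closed A : GRing.submod_closed (quot_image A).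
Proof.
split; first by apply/asboolP; exists 0; rewrite ?rpred0 ?raddf0.
move=> a _ _ /asboolP[x xA ->] /asboolP[y yA ->].
by apply/asboolP; exists (a *: x + y); rewrite ?linearP // rpredD ?rpredZ.
Qed.

HB.instance Definition _ A :=
  GRing.isSubmodClosed.Build R Q (quot_image A) (quot_image_closed A).

End ModuleConstructions.

Arguments quot_image {R V} S A _.

Section SubQuotient.
Variables (R : pzRingType) (V : lmodType R).

Definition subquot (B A : submodClosed V) : lmodType R := submod (quot_image B A).

Definition composition_series (n : nat) (C : nat -> submodClosed V) : Prop :=
  [/\ C 0 =i pred1 0, C n =i predT &
      forall j, (j < n)%N ->
        {subset C j <= C j.+1} /\ simple_module (subquot (C j) (C j.+1))].

End SubQuotient.

(* I N: when I is a left ideal, this is the set of finite sums of products.   *)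
Definition smul (R : pzRingType) (V : lmodType R) (I : {pred R})
    (N : {pred V}) : submodClosed V :=
  lspan (fun w => exists a v, [/\ a \in I, v \in N & w = a *: v]).

Section Radical.
Variable A : nzRingType.

Definition maximal_left_ideal (I : submodClosed A^o) : Prop :=
  1 \notin I /\
  forall K : submodClosed A^o, 1 \notin K -> {subset I <= K} -> K =i I.

Definition Jac_pred : {pred A^o} :=
  fun a => `[< forall I : submodClosed A^o, maximal_left_ideal I -> a \in I >].

Lemma Jac_closed : GRing.submod_closed Jac_pred.
Proof.
split; first by apply/asboolP => I _; exact: rpred0.
move=> a u v /asboolP uJ /asboolP vJ; apply/asboolP => I maxI.
by rewrite rpredD ?rpredZ ?uJ ?vJ.
Qed.

HB.instance Definition _ :=
  GRing.isSubmodClosed.Build A A^o Jac_pred Jac_closed.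

Definition Jac : submodClosed A^o := Jac_pred.

Definition Jac2 : submodClosed A^o := smul Jac Jac.

Definition second_Loewy_layer (M : lmodType A) : lmodType A :=
  subquot (smul Jac2 (predT : {pred M})) (smul Jac (predT : {pred M})).

Definition projective (P : lmodType A) : Prop :=
  forall (M N : lmodType A) (g : {linear M -> N}) (f : {linear P -> N}),
    (forall y, exists x, g x = y) ->
    exists h : {linear P -> M}, forall x, g (h x) = f x.

Definition projective_cover (P M : lmodType A) (pi : {linear P -> M}) : Prop :=
  [/\ projective P, forall y, exists x, pi x = y &
      forall N : submodClosed P,
        (forall x, exists y z, [/\ y \in N, pi z = 0 & x = y + z]) ->
        N =i predT].

End Radical.

HB.mixin Record isLieAlgebra (F : fieldType) L of GRing.Lmodule F L := {
  bracket : L -> L -> L;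
  bracketDl : forall y, {morph bracket^~ y : x x' / x + x'};
  bracketZl : forall a x y, bracket (a *: x) y = a *: bracket x y;
  bracketDr : forall x, {morph bracket x : y y' / y + y'};
  bracketZr : forall a x y, bracket x (a *: y) = a *: bracket x y;
  bracketxx : forall x, bracket x x = 0;
  jacobi : forall x y z,
    bracket x (bracket y z) + bracket y (bracket z x) +
      bracket z (bracket x y) = 0
}.

#[short(type="lieAlgType")]
HB.structure Definition LieAlgebra (F : fieldType) :=
  {L of isLieAlgebra F L & GRing.Lmodule F L}.

Notation "[[ x , y ]]" := (bracket x y) : ring_scope.

(* The coefficient of t ^ k in ad(t x + y) ^ m (x). *)
Fixpoint ad_coef (F : fieldType) (L : lieAlgType F) (x y : L) (m k : nat) : L :=
  if m is m'.+1 then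
    [[y, ad_coef x y m' k]] + (if k is k'.+1 then [[x, ad_coef x y m' k']] else 0)
  else (if k is 0%N then x else 0).

(* ppowD is Jacobson's formula: the correction terms s_i (0 < i < p) are      *)
(* given by \sum_i i s_i(x, y) t ^ (i - 1) = ad(t x + y) ^ (p - 1) (x).       *)
HB.mixin Record isRestrictedLie (F : fieldType) (p : nat) L
    of LieAlgebra F L := {
  ppow : L -> L;
  ppow_ad : forall x y : L, [[ppow x, y]] = iter p (bracket x) y;
  ppowZ : forall (a : F) (x : L), ppow (a *: x) = a ^+ p *: ppow x;
  ppowD : forall x y : L,
    ppow (x + y) =
      ppow x + ppow y + \sum_(1 <= i < p) i%:R^-1 *: ad_coef x y p.-1 i.-1
}.

#[short(type="restrictedLieType")]
HB.structure Definition RestrictedLie (F : fieldType) (p : nat) :=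
  {L of isRestrictedLie F p L & LieAlgebra F L}.

#[short(type="fdRestrictedLieType")]
HB.structure Definition FdRestrictedLie (F : fieldType) (p : nat) :=
  {L of RestrictedLie F p L & Vector F L}.

HB.mixin Record isLieIdeal (F : fieldType) (L : lieAlgType F) (S : {pred L}) := {
  ideal_bracket : forall x y, y \in S -> [[x, y]] \in S
}.

#[short(type="lieIdeal")]
HB.structure Definition LieIdeal (F : fieldType) (L : lieAlgType F) :=
  {S of @GRing.SubmodClosed F L S & isLieIdeal F L S}.

Section LieAlgebras.
Variables (F : fieldType) (L : lieAlgType F).

Fixpoint derived (n : nat) : {pred L} :=
  if n is n'.+1 then
    lspan (fun z => exists x y,
             [/\ x \in derived n', y \in derived n' & z = [[x, y]]])
  else predT.

Definition lie_solvable : Prop := exists n, {subset derived n <= pred1 0}.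

Definition minimal_ideal (I : lieIdeal L) : Prop :=
  ~ (I =i pred1 0) /\
  forall K : lieIdeal L, {subset K <= I} -> K =i pred1 0 \/ K =i I.

Lemma bracketN_anti (x y : L) : [[x, y]] = - [[y, x]].
Proof.
apply/eqP; rewrite -addr_eq0; apply/eqP.
have := bracketxx (x + y).
by rewrite bracketDl !bracketDr !bracketxx add0r addr0.
Qed.

Lemma bracketNr (x y : L) : [[x, - y]] = - [[x, y]].
Proof. by rewrite -scaleN1r bracketZr scaleN1r. Qed.

Lemma bracketNl (x y : L) : [[- x, y]] = - [[x, y]].
Proof. by rewrite -scaleN1r bracketZl scaleN1r. Qed.

Lemma ideal_bracketl (I : lieIdeal L) x y : x \in I -> [[x, y]] \in I.
Proof. by move=> xI; rewrite bracketN_anti -scaleN1r rpredZ ?ideal_bracket. Qed.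

Definition lie_quot (J : lieIdeal L) : Type := quotmod J.

Variable J : lieIdeal L.
Local Notation Q := (lie_quot J).

HB.instance Definition _ := GRing.Lmodule.on Q.
HB.instance Definition _ := EqQuotient.on Q.
HB.instance Definition _ := GRing.Linear.copy (\pi_Q : L -> Q) (\pi_(quotmod J)).

Definition quot_bracket (q r : Q) : Q := \pi_Q [[repr q, repr r]].

Lemma quot_bracketE x y : quot_bracket (\pi_Q x) (\pi_Q y) = \pi_Q [[x, y]].
Proof.
rewrite /quot_bracket; apply/quotmod_eqP; set x' := repr _; set y' := repr _.
have xJ : x' - x \in J by apply/quotmod_eqP; rewrite reprK.
have yJ : y' - y \in J by apply/quotmod_eqP; rewrite reprK.
have -> : [[x', y']] - [[x, y]] = [[x' - x, y']] + [[x, y' - y]].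
  by rewrite bracketDl bracketDr bracketNl bracketNr addrA subrK.
by apply: rpredD; [exact: ideal_bracketl | exact: ideal_bracket].
Qed.

Lemma quot_bracketDl r : {morph quot_bracket^~ r : q q' / q + q'}.
Proof.
move=> q q'; rewrite -[q]reprK -[q']reprK -[r]reprK.
by rewrite -raddfD !quot_bracketE -raddfD bracketDl.
Qed.

Lemma quot_bracketZl a q r : quot_bracket (a *: q) r = a *: quot_bracket q r.
Proof.
rewrite -[q]reprK -[r]reprK.
by rewrite -linearZ !quot_bracketE -linearZ bracketZl.
Qed.

Lemma quot_bracketDr q : {morph quot_bracket q : r r' / r + r'}.
Proof.
move=> r r'; rewrite -[q]reprK -[r']reprK -[r]reprK.
by rewrite -raddfD !quot_bracketE -raddfD bracketDr.
Qed.

Lemma quot_bracketZr a q r : quot_bracket q (a *: r) = a *: quot_bracket q r.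
Proof.
rewrite -[q]reprK -[r]reprK.
by rewrite -linearZ !quot_bracketE -linearZ bracketZr.
Qed.

Lemma quot_bracketxx q : quot_bracket q q = 0.
Proof. by rewrite -[q]reprK quot_bracketE bracketxx raddf0. Qed.

Lemma quot_jacobi q r s :
  quot_bracket q (quot_bracket r s) + quot_bracket r (quot_bracket s q) +
    quot_bracket s (quot_bracket q r) = 0.
Proof.
rewrite -[q]reprK -[r]reprK -[s]reprK.
move: (repr q) (repr r) (repr s) => x y z.
rewrite (quot_bracketE y z) (quot_bracketE z x) (quot_bracketE x y).
by rewrite !quot_bracketE -!raddfD jacobi raddf0.
Qed.

HB.instance Definition _ := isLieAlgebra.Build F Q
  quot_bracketDl quot_bracketZl quot_bracketDr quot_bracketZr
  quot_bracketxx quot_jacobi.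

Definition ideal_image (I : lieIdeal L) : {pred Q} := quot_image J I.

Lemma ideal_image_bracket I x y :
  y \in ideal_image I -> [[x, y]] \in ideal_image I.
Proof.
move=> /asboolP[z zI ->]; rewrite -[x]reprK; apply/asboolP.
by exists [[repr x, z]]; [exact: ideal_bracket | exact: quot_bracketE].
Qed.

HB.instance Definition _ I := GRing.SubmodClosed.copy (ideal_image I) (quot_image J I).
HB.instance Definition _ I := isLieIdeal.Build F Q (ideal_image I)
  (@ideal_image_bracket I).

End LieAlgebras.

Arguments ideal_image {F L} J I _.

HB.mixin Record isLieModule (F : fieldType) (L : lieAlgType F) M
    of GRing.Lmodule F M := {
  lact : L -> M -> M;
  lactDl : forall v, {morph lact^~ v : x y / x + y};
  lactZl : forall a x v, lact (a *: x) v = a *: lact x v;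
  lactDr : forall x, {morph lact x : v w / v + w};
  lactZr : forall a x v, lact x (a *: v) = a *: lact x v;
  lact_bracket : forall x y v,
    lact [[x, y]] v = lact x (lact y v) - lact y (lact x v)
}.

#[short(type="lieModType")]
HB.structure Definition LieModule (F : fieldType) (L : lieAlgType F) :=
  {M of isLieModule F L M & GRing.Lmodule F M}.

Section LieModules.
Variables (F : fieldType) (L : lieAlgType F).

Definition lie_module_hom (M N : lieModType L) (f : M -> N) : Prop :=
  linear f /\ forall (x : L) v, f (lact x v) = lact x (f v).

Definition lie_module_iso (M N : lieModType L) : Prop :=
  exists2 f : M -> N, lie_module_hom f & bijective f.

Definition direct_summand (S M : lieModType L) : Prop :=
  exists (C : lieModType L) (f : S -> M) (g : C -> M),
    [/\ lie_module_hom f, lie_module_hom g &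
        bijective (fun sc : S * C => f sc.1 + g sc.2)].

End LieModules.

Definition trivmod (F : fieldType) (L : lieAlgType F) : Type := F^o.
HB.instance Definition _ (F : fieldType) (L : lieAlgType F) :=
  GRing.Lmodule.copy (trivmod L) F^o.

Section TrivialModule.
Variables (F : fieldType) (L : lieAlgType F).

Definition triv_act (x : L) (v : trivmod L) : trivmod L := 0.

Lemma triv_actDl v : {morph triv_act^~ v : x y / x + y}.
Proof. by move=> x y; rewrite addr0. Qed.

Lemma triv_actZl a x v : triv_act (a *: x) v = a *: triv_act x v.
Proof. by rewrite scaler0. Qed.

Lemma triv_actDr x : {morph triv_act x : v w / v + w}.
Proof. by move=> v w; rewrite addr0. Qed.

Lemma triv_actZr a x v : triv_act x (a *: v) = a *: triv_act x v.
Proof. by rewrite scaler0. Qed.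

Lemma triv_act_bracket x y v :
  triv_act [[x, y]] v = triv_act x (triv_act y v) - triv_act y (triv_act x v).
Proof. by rewrite subr0. Qed.

HB.instance Definition _ := isLieModule.Build F L (trivmod L)
  triv_actDl triv_actZl triv_actDr triv_actZr triv_act_bracket.

End TrivialModule.

Section ChiefFactors.
Variables (F : fieldType) (L : lieAlgType F).

Definition chief_series (n : nat) (C : nat -> lieIdeal L) : Prop :=
  [/\ C 0 =i pred1 0, C n =i predT &
      forall j, (j < n)%N ->
        {subset C j <= C j.+1} /\ minimal_ideal (ideal_image (C j) (C j.+1))].

(* The canonical projection L / J -> L / I, for J contained in I. *)
Definition lie_quot_map (J I : lieIdeal L) (q : lie_quot J) : lie_quot I :=
  \pi_(lie_quot I) (repr q).

Arguments lie_quot_map J I q : clear implicits.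

(* 0 -> I / J -> L / J -> L / I -> 0 splits in the category of Lie algebras:  *)
(* the projection has a section which is a Lie algebra homomorphism.          *)
Definition split_factor (J I : lieIdeal L) : Prop :=
  exists s : lie_quot I -> lie_quot J,
    [/\ linear s, {morph s : x y / [[x, y]]} &
        cancel s (lie_quot_map J I)].

Variables J I : lieIdeal L.

Definition chief_factor : Type := submod (ideal_image J I).
HB.instance Definition _ := GRing.Lmodule.on chief_factor.

Definition adj_act (x : L) (v : chief_factor) : chief_factor :=
  exist _ [[\pi_(lie_quot J) x, \val v]]
    (ideal_bracket (\pi_(lie_quot J) x) _ (valP v)).

Lemma adj_actDl v : {morph adj_act^~ v : x y / x + y}.
Proof. by move=> x y; apply: val_inj; rewrite /= raddfD bracketDl. Qed.

Lemma adj_actZl a x v : adj_act (a *: x) v = a *: adj_act x v.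
Proof. by apply: val_inj; rewrite /= linearZ bracketZl. Qed.

Lemma adj_actDr x : {morph adj_act x : v w / v + w}.
Proof. by move=> v w; apply: val_inj; rewrite /= bracketDr. Qed.

Lemma adj_actZr a x v : adj_act x (a *: v) = a *: adj_act x v.
Proof. by apply: val_inj; rewrite /= bracketZr. Qed.

Lemma adj_act_bracket x y v :
  adj_act [[x, y]] v = adj_act x (adj_act y v) - adj_act y (adj_act x v).
Proof.
apply: val_inj => /=; rewrite -[\pi_ _ [[x, y]]]quot_bracketE.
set x' := \pi_ _ x; set y' := \pi_ _ y; set w := sval v.
have := jacobi x' y' w.
rewrite [X in _ + X]bracketN_anti (bracketN_anti w x') bracketNr.
by move/eqP; rewrite subr_eq0 => /eqP ->.
Qed.

HB.instance Definition _ := isLieModule.Build F L chief_factor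
  adj_actDl adj_actZl adj_actDr adj_actZr adj_act_bracket.

End ChiefFactors.

Definition restricted_morphism (F : fieldType) (p : nat)
    (L : restrictedLieType F p) (A : algType F) (f : L -> A) : Prop :=
  [/\ linear f, forall x y, f [[x, y]] = f x * f y - f y * f x &
      forall x, f (ppow x) = f x ^+ p].

(* u(L), a finite-dimensional algebra specified by its universal property.    *)
Record restrictedEnvelope (F : fieldType) (p : nat)
    (L : restrictedLieType F p) := RestrictedEnvelope {
  env_alg :> falgType F;
  env_in : L -> env_alg;
  env_in_morph : restricted_morphism env_in;
  env_universal : forall (A : algType F) (f : L -> A), restricted_morphism f ->
    exists2 g : {lrmorphism env_alg -> A},
      forall x, g (env_in x) = f x &
      forall h : {lrmorphism env_alg -> A},
        (forall x, h (env_in x) = f x) -> h =1 g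
}.

Section EnvelopeModules.
Variables (F : fieldType) (p : nat) (L : restrictedLieType F p).
Variable u : restrictedEnvelope L.

(* The restriction of a u(L)-module along F -> u(L) and L -> u(L). *)
Definition env_mod (M : lmodType u) : Type := M.

Section Instances.
Variable M : lmodType u.
Local Notation V := (env_mod M).

HB.instance Definition _ := GRing.Zmodule.copy V M.

Definition env_scale (a : F) (v : V) : V := (a%:A : u) *: (v : M).

Lemma env_scalerA a b v : env_scale a (env_scale b v) = env_scale (a * b) v.
Proof. by rewrite /env_scale scalerA mulr_algl scalerA. Qed.

Lemma env_scale1r : left_id 1 env_scale.
Proof. by move=> v; rewrite /env_scale scale1r [LHS](@scale1r u M). Qed.

Lemma env_scalerDr : right_distributive env_scale +%R.
Proof. by move=> a v w; exact: (@scalerDr u M). Qed.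

Lemma env_scalerDl v : {morph env_scale^~ v : a b / a + b}.
Proof. by move=> a b; rewrite /env_scale scalerDl [LHS](@scalerDl u M). Qed.

HB.instance Definition _ := GRing.Zmodule_isLmodule.Build F V
  env_scalerA env_scale1r env_scalerDr env_scalerDl.

Definition env_act (x : L) (v : V) : V := env_in u x *: (v : M).

Lemma env_actDl v : {morph env_act^~ v : x y / x + y}.
Proof.
move=> x y; have [lin _ _] := env_in_morph u.
by rewrite /env_act -[x]scale1r lin !scale1r [LHS](@scalerDl u M).
Qed.

Lemma env_in0 : env_in u 0 = 0.
Proof.
have [lin _ _] := env_in_morph u.
by have /eqP := lin 1 0 0; rewrite !scale1r addr0 -subr_eq subrr => /eqP <-.
Qed.

Lemma env_actZl a x v : env_act (a *: x) v = a *: env_act x v.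
Proof.
have [lin _ _] := env_in_morph u.
rewrite /env_act -[a *: x]addr0 lin env_in0 addr0.
by rewrite [RHS](@scalerA u M) mulr_algl.
Qed.

Lemma env_actDr x : {morph env_act x : v w / v + w}.
Proof. by move=> v w; exact: (@scalerDr u M). Qed.

Lemma env_actZr a x v : env_act x (a *: v) = a *: env_act x v.
Proof. by rewrite [LHS](@scalerA u M) [RHS](@scalerA u M) mulr_algl mulr_algr. Qed.

Lemma env_act_bracket x y v :
  env_act [[x, y]] v = env_act x (env_act y v) - env_act y (env_act x v).
Proof.
have [_ br _] := env_in_morph u.
by rewrite /env_act br [LHS](@scalerBl u M) !scalerA.
Qed.

HB.instance Definition _ := isLieModule.Build F L V
  env_actDl env_actZl env_actDr env_actZr env_act_bracket.

End Instances.

Definition composition_factor (S : lieModType L) (M : lmodType u) : Prop :=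
  exists n (C : nat -> submodClosed M), composition_series n C /\
    exists2 j, (j < n)%N &
      lie_module_iso S (env_mod (subquot (C j) (C j.+1))).

End EnvelopeModules.

(* Main.v *)
From HB Require Import structures.
Require Import Defs.
From mathcomp Require Import all_boot all_order all_algebra all_field.
From mathcomp Require Import ring_quotient generic_quotient.
From mathcomp Require Import boolp functions.

Set Implicit Arguments.
Unset Strict Implicit.
Unset Printing Implicit Defensive.

Import GRing.Theory.
Local Open Scope ring_scope.
Local Open Scope quotient_scope.

(** Let S = I / J be a split chief factor of L, an abelian minimal ideal of
    L / J because L is solvable. Subtracting from x in L the image of x under
    the chosen section L / I -> L / J leaves a component D x in S, and D is a
    derivation of L with values in S. It is not inner, since I acts by zero
    on S while D maps I onto S. So the Lie module E = S + F, where x maps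
    (v, c) to (x v + c D x, 0), is a non-split extension of the trivial module
    by S.

    The splitting is one of ordinary Lie algebras, so E has to be shown to be
    restricted (ext_rep_ppow). The operator x ^ p - x^[p] on E commutes with
    L, as both terms induce the p-th power of ad x, and it maps E into S and S
    to zero. Hence its values are invariants of S, and these vanish when S is
    irreducible and non-trivial. By its universal property u(L) then acts on E.

    Lift P -> F along E -> F to a map h : P -> E. The Jacobson radical kills
    the simple modules S and F, so h maps Jac P into S and Jac^2 P to zero. If
    h killed Jac P, then the vector of E over 1 that generates h P would be
    killed by Jac, hence could be replaced by one with the same annihilator as
    its image 1 in F (cyclic_lift), that is, by an invariant vector; this
    would make D inner. So Jac P / Jac^2 P maps onto S, and again by
    cyclic_lift this surjection splits, which is the direct summand claimed.

    The module P is cyclic, hence of finite length, so it has a composition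
    series through any two submodules of which one covers the other. Taking
    ker h and the preimage of S shows that S is a composition factor; when S
    is trivial, the quotient of P by the kernel of P -> F does instead. *)

(** * Submodules, subquotients and composition series *)

Section Submodules.
Variables (R : pzRingType) (V : lmodType R).

Lemma lspan_gen (X : V -> Prop) w : X w -> w \in lspan X.
Proof. by move=> Xw; apply/asboolP => S; apply. Qed.

Lemma lspan_min (X : V -> Prop) (S : submodClosed V) :
  (forall w, X w -> w \in S) -> {subset lspan X <= S}.
Proof. by move=> XS w /asboolP; apply. Qed.

(** This makes lspan the uniform way to turn a closed property into a bundled
    submodule. *)
Lemma lspanP (X : V -> Prop) :
    X 0 -> (forall a v w, X v -> X w -> X (a *: v + w)) ->
  forall v, reflect (X v) (v \in lspan X).
Proof.
move=> X0 XD v.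
have clX : GRing.submod_closed (fun w => `[< X w >] : bool).
  split=> [|a w w' /asboolP Xw /asboolP Xw']; apply/asboolP => //.
  exact: XD.
pose S : submodClosed V :=
  HB.pack (fun w => `[< X w >] : bool) (GRing.isSubmodClosed.Build R V _ clX).
apply: (iffP idP) => [|Xv]; last exact: lspan_gen.
by move/(lspan_min (S := S)) => vS; apply/asboolP/vS => w Xw; apply/asboolP.
Qed.

Definition full_sub : submodClosed V := lspan (fun=> True).

Lemma in_full_sub v : v \in full_sub.
Proof. exact: lspan_gen. Qed.

Definition zero_sub : submodClosed V := lspan (fun v => v = 0).

Lemma in_zero_sub v : (v \in zero_sub) = (v == 0).
Proof. by apply/lspanP/eqP => // a x y -> ->; rewrite scaler0 addr0. Qed.

(** The zero submodule is allowed, so this means zero or simple. *)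
Definition minimal_submod (S : submodClosed V) : Prop :=
  forall K : submodClosed V, {subset K <= S} -> K =i pred1 0 \/ K =i S.

End Submodules.

Arguments full_sub {R} V.
Arguments zero_sub {R} V.

Section Preimage.
Variables (R : pzRingType) (V W : lmodType R) (h : {linear V -> W}).

Definition preim_sub (N : submodClosed W) : submodClosed V :=
  lspan (fun x => h x \in N).

Lemma in_preim_sub N x : (x \in preim_sub N) = (h x \in N).
Proof.
apply/lspanP/idP => //; first by rewrite raddf0 rpred0.
by move=> a v w hv hw; rewrite linearP rpredD ?rpredZ.
Qed.

Definition image_sub (K : submodClosed V) : submodClosed W :=
  lspan (fun y => exists2 x, x \in K & y = h x).

Lemma image_subP (K : submodClosed V) y :
  reflect (exists2 x, x \in K & y = h x) (y \in image_sub K).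
Proof.
apply: lspanP; first by exists 0; rewrite ?rpred0 ?raddf0.
move=> a _ _ [x xK ->] [z zK ->]; exists (a *: x + z); last by rewrite linearP.
by rewrite rpredD // rpredZ.
Qed.

Definition ker_sub : submodClosed V := lspan (fun x => h x = 0).

Lemma in_ker_sub x : (x \in ker_sub) = (h x == 0).
Proof.
apply/lspanP/eqP => //; first by rewrite raddf0.
by move=> a v w hv hw; rewrite linearP hv hw scaler0 addr0.
Qed.

End Preimage.

Section Subquotients.
Variables (R : pzRingType) (V W : lmodType R).
Variables (h : {linear V -> W}) (B A : submodClosed V).
Hypothesis hB : forall x, x \in B -> h x = 0.

(** The map induced on A / B; here A / B is the set of classes in V / B of the
    elements of A, and any representative gives the same value. *)
Definition subquot_map (q : subquot B A) : W := h (repr (\val q : quotmod B)).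

Lemma repr_subquot x : h (repr (\pi_(quotmod B) x)) = h x.
Proof.
apply/eqP; rewrite -subr_eq0 -raddfB; apply/eqP/hB.
by apply/quotmod_eqP; rewrite reprK.
Qed.

Lemma subquot_map_linear : linear subquot_map.
Proof.
move=> a q r; rewrite /subquot_map -linearP /= -[RHS]repr_subquot.
by congr (h (repr _)); rewrite linearP /= !reprK.
Qed.

Lemma subquot_surj (q : subquot B A) :
  exists2 x, x \in A & \val q = \pi_(quotmod B) x.
Proof. by case: q => q /= /asboolP[x xA ->]; exists x. Qed.

Lemma subquot_mapE x (q : subquot B A) :
  \val q = \pi_(quotmod B) x -> subquot_map q = h x.
Proof. by move=> qE; rewrite /subquot_map qE repr_subquot. Qed.

Lemma subquot_lift x : x \in A -> exists q : subquot B A, \val q = \pi_(quotmod B) x.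
Proof.
move=> xA; have xq : \pi_(quotmod B) x \in quot_image B A.
  by apply/asboolP; exists x.
by exists (exist (fun y => y \in quot_image B A) _ xq).
Qed.

End Subquotients.

Section Chains.
Variables (R : pzRingType) (M : lmodType R).
Implicit Types A B K : submodClosed M.

Definition covers A B : Prop :=
  [/\ {subset A <= B}, exists2 x, x \in B & x \notin A &
    forall K, {subset A <= K} -> {subset K <= B} -> K =i A \/ K =i B].

(** The submodules between the kernel and the preimage of N correspond to the
    submodules of N. *)
Lemma covers_preim_sub (W : lmodType R) (h : {linear M -> W}) (N : submodClosed W) :
    minimal_submod N -> (exists2 y, y \in N & y != 0) ->
    {subset N <= image_sub h (full_sub M)} ->
  covers (ker_sub h) (preim_sub h N).
Proof.
move=> minN [y yN y0] N_im; split=> [x||K sAK sKB].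
- by rewrite in_ker_sub in_preim_sub => /eqP ->; apply: rpred0.
- have /image_subP[x _ yE] := N_im y yN.
  by exists x; rewrite ?in_preim_sub ?in_ker_sub -yE.
have [|eq0|eqN] := minN (image_sub h K).
- by move=> _ /image_subP[x /sKB xB ->]; rewrite in_preim_sub in xB.
- left=> x; apply/idP/idP => [xK|]; last exact: sAK.
  by rewrite in_ker_sub -[_ == 0]/(_ \in pred1 0) -eq0; apply/image_subP; exists x.
right=> x; apply/idP/idP => [/sKB //|]; rewrite in_preim_sub -eqN.
case/image_subP => z zK hx; rewrite -(subrK z x) rpredD // sAK //.
by rewrite in_ker_sub raddfB subr_eq0; apply/eqP.
Qed.

Lemma covers_simple A B : covers A B -> simple_module (subquot A B).
Proof.
case=> sAB [x xB xA] minAB; split.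
  have [q qE] := subquot_lift A xB; exists q; apply: contraNneq xA => q0.
  by rewrite -[x]subr0; apply/quotmod_eqP; rewrite -qE q0 /= raddf0.
move=> S.
pose X y := y \in B /\ exists2 q : subquot A B, q \in S & \val q = \pi_(quotmod A) y.
have inX : forall y, reflect (X y) (y \in lspan X).
  apply: lspanP.
    by split; [exact: rpred0 | exists 0; [exact: rpred0 | rewrite !raddf0] ].
  move=> a y z [yB [q qS qE] ] [zB [r rS rE] ]; split; first by rewrite rpredD ?rpredZ.
  by exists (a *: q + r); rewrite ?rpredD ?rpredZ // !linearP /= qE rE.
have [y yA|y /inX[]//|XA|XB] := minAB (lspan X).
- apply/inX; split; first exact: sAB.
  exists 0; rewrite ?rpred0 // raddf0 -(raddf0 (\pi_(quotmod A))).
  by apply/esym/quotmod_eqP; rewrite subr0.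
- left=> q; apply/idP/idP => [qS|]; last by rewrite inE => /eqP ->; apply: rpred0.
  have [y yB qE] := subquot_surj q; rewrite inE -val_eqE /= qE.
  rewrite -(raddf0 (\pi_(quotmod A))); apply/eqP/quotmod_eqP.
  by rewrite subr0 -XA; apply/inX; split=> //; exists q.
right=> q; have [y yB qE] := subquot_surj q.
move: (yB); rewrite -XB => /inX[_ [r rS rE] ].
by rewrite [RHS]inE; suff -> : q = r by []; apply: val_inj; rewrite qE.
Qed.

(** Any strictly increasing function into the natural numbers can serve as the
    length on which the construction of composition series recurses. *)
Variable rank : submodClosed M -> nat.
Hypothesis rank_lt : forall A B, {subset A <= B} ->
  (exists2 x, x \in B & x \notin A) -> (rank A < rank B)%N.

Lemma eq_or_gap A B : {subset A <= B} -> A =i B \/ exists2 x, x \in B & x \notin A.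
Proof.
move=> sAB; have [sBA|/existsNP[x /not_implyP[xB /negP xA] ] ] := pselect {subset B <= A}.
  by left=> x; apply/idP/idP => [/sAB|/sBA].
by right; exists x.
Qed.

Lemma covers_eql A A' B : A =i A' -> covers A B -> covers A' B.
Proof.
move=> eqA [sAB [x xB xA] minAB]; split=> [y|| K sA'K sKB].
- by rewrite -eqA => /sAB.
- by exists x; rewrite -?eqA.
have sAK : {subset A <= K} by move=> y; rewrite eqA => /sA'K.
by have [eqK|] := minAB K sAK sKB; [left => y; rewrite eqK | right].
Qed.

Definition covers_upto n (C : nat -> submodClosed M) : Prop :=
  forall i, (i < n)%N -> covers (C i) (C i.+1).

(** The last term of C and the first term of D are meant to coincide. *)
Definition glue n (C D : nat -> submodClosed M) i :=
  if (i <= n)%N then C i else D (i - n)%N.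

Lemma glueE n C D i : C n = D 0 -> glue n C D (n + i) = D i.
Proof.
move=> eqCD; rewrite /glue; case: i => [|i]; first by rewrite addn0 leqnn.
by rewrite addnS leqNgt ltnS leq_addr -addnS addKn.
Qed.

Lemma covers_glue n m C D : C n = D 0 ->
  covers_upto n C -> covers_upto m D -> covers_upto (n + m) (glue n C D).
Proof.
move=> eqCD covC covD i lti; have [ltin|lein] := ltnP i n.
  by rewrite /glue ltin ltnW //; apply: covC.
move: lti; rewrite -(subnKC lein) ltn_add2l => /covD.
by rewrite -addnS !glueE.
Qed.

(** If B does not cover A, then some K lies strictly between them, and both
    gaps have smaller rank difference. *)
Lemma chain_exists A B : {subset A <= B} ->
  exists (n : nat) (C : nat -> submodClosed M), [/\ C 0 = A, C n =i B & covers_upto n C].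
Proof.
have [m] := ubnP (rank B - rank A); elim: m A B => // m IHm A B ltm sAB.
have [eqAB|ltAB] := eq_or_gap sAB; first by exists 0%N, (fun=> A).
have [covAB|ncov] := pselect (covers A B).
  by exists 1%N, (fun i => if i is 0%N then A else B); split=> // -[].
have [K [sAK [sKB [ltAK ltKB] ] ] ] :
    exists K, {subset A <= K} /\ {subset K <= B} /\
    (exists2 x, x \in K & x \notin A) /\ (exists2 x, x \in B & x \notin K).
  apply: contrapT => /forallNP noK; apply: ncov; split=> // K sAK sKB.
  have [eqAK|ltAK] := eq_or_gap sAK; first by left=> x; rewrite eqAK.
  have [eqKB|ltKB] := eq_or_gap sKB; first by right.
  by case: (noK K).
have rAK := rank_lt sAK ltAK; have rKB := rank_lt sKB ltKB.
have [|n1 [C1 [C10 C1n covC1] ] ] := IHm A K _ sAK.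
  by rewrite -ltnS; apply: leq_trans ltm; rewrite ltnS ltn_sub2r // (ltn_trans rAK).
(* The chain ends in a submodule with the same elements as K, which need not
   be the same bundled structure; the second chain starts from that one. *)
have sK'B : {subset C1 n1 <= B} by move=> x; rewrite C1n => /sKB.
have [|n2 [C2 [C20 C2n covC2] ] ] := IHm (C1 n1) B _ sK'B.
  rewrite -ltnS; apply: leq_trans ltm; rewrite ltnS.
  have : (rank A < rank (C1 n1))%N.
    apply: rank_lt => [x /sAK|]; first by rewrite C1n.
    by case: ltAK => x xK xA; exists x; rewrite ?C1n.
  by move=> r1; rewrite ltn_sub2l // (ltn_trans rAK).
exists (n1 + n2)%N, (glue n1 C1 C2); split; first by rewrite /glue leq0n.
  by move=> x; rewrite glueE ?C2n // C20.
exact: covers_glue.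
Qed.

(** The last term is B itself, but the one before is only extensionally equal
    to A, as it ends a chain built from below. *)
Lemma composition_series_through A B : covers A B ->
  exists n (C : nat -> submodClosed M), composition_series n C /\
    exists2 j, (j < n)%N & C j =i A /\ C j.+1 = B.
Proof.
move=> covAB; have [|n1 [C1 [C10 C1n covC1] ] ] := @chain_exists (zero_sub M) A.
  by move=> x; rewrite in_zero_sub => /eqP ->; apply: rpred0.
have [|n2 [C2 [C20 C2n covC2] ] ] := @chain_exists B (full_sub M).
  by move=> x _; apply: in_full_sub.
pose step i := if i is 0%N then C1 n1 else B.
have cov1 : covers_upto 1 step.
  by move=> [|//] _; apply: covers_eql covAB => x; rewrite C1n.
have cov2 : covers_upto (1 + n2) (glue 1 step C2) by apply: covers_glue.
have eqC : C1 n1 = glue 1 step C2 0 by [].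
exists (n1 + (1 + n2))%N, (glue n1 C1 (glue 1 step C2)); split.
  split=> [x|x|i lti].
  - by rewrite /glue /= C10 in_zero_sub.
  - by rewrite !glueE ?C20 // C2n in_full_sub.
  - have cov := covers_glue eqC covC1 cov2 lti.
    by split; [case: cov | exact: covers_simple].
exists n1; first by rewrite -addSnnS leq_addr.
by split=> [x|]; [rewrite /glue leqnn C1n | rewrite -[n1.+1]addn1 glueE].
Qed.

End Chains.

(** * The Jacobson radical *)

(** The closure properties of a submodule of the regular module, stated with
    the multiplication of the ring. *)
Section LeftIdeals.
Variables (R : nzRingType) (K : submodClosed R^o).

Lemma lideal0 : (0 : R) \in K. Proof. exact: (@rpred0 _ K). Qed.

Lemma lidealD (x y : R) : x \in K -> y \in K -> x + y \in K.
Proof. exact: (@rpredD _ K x y). Qed.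

Lemma lidealM (a x : R) : x \in K -> a * x \in K.
Proof. exact: (@rpredZ _ _ K a x). Qed.

Lemma lidealB (x y : R) : x \in K -> y \in K -> x - y \in K.
Proof. by move=> xK yK; rewrite -mulN1r lidealD ?lidealM. Qed.

End LeftIdeals.

Section Transporter.
Variables (R : nzRingType) (M : lmodType R).

Definition colon (N : submodClosed M) (v : M) : submodClosed R^o :=
  lspan (fun a : R^o => (a : R) *: v \in N).

Lemma in_colon N v (a : R) : (a \in colon N v) = (a *: v \in N).
Proof.
apply/lspanP/idP => //; first by rewrite scale0r rpred0.
by move=> b x y hx hy; rewrite scalerDl -scalerA rpredD // rpredZ.
Qed.

Definition ann (v : M) : submodClosed R^o :=
  lspan (fun a : R^o => (a : R) *: v = 0).

Lemma in_ann v (a : R) : (a \in ann v) = (a *: v == 0).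
Proof.
apply/lspanP/eqP => //; first by rewrite scale0r.
by move=> b x y hx hy; rewrite scalerDl -scalerA hx hy scaler0 addr0.
Qed.

Definition orbit_sub (K : submodClosed R^o) (v : M) : submodClosed M :=
  lspan (fun w => exists2 a : R, a \in K & w = a *: v).

Lemma orbit_subP (K : submodClosed R^o) v w :
  reflect (exists2 a : R, a \in K & w = a *: v) (w \in orbit_sub K v).
Proof.
apply: lspanP; first by exists 0; rewrite ?lideal0 ?scale0r.
move=> b _ _ [x xK ->] [y yK ->]; exists (b * x + y); last first.
  by rewrite scalerDl scalerA.
by rewrite lidealD ?lidealM.
Qed.

(** The annihilator of a nonzero vector of a simple module is a maximal left
    ideal: a larger left ideal K has K v nonzero, so v = b v with b in K, and
    then 1 - b annihilates v and 1 lies in K. *)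
Lemma Jac_minimal_submod (S : submodClosed M) (a : R) v :
  minimal_submod S -> a \in Jac R -> v \in S -> a *: v = 0.
Proof.
move=> minS /asboolP aJ vS; have [->|v0] := eqVneq v 0; first exact: scaler0.
suff /aJ : maximal_left_ideal (ann v) by rewrite in_ann => /eqP.
split=> [|K K1 sub_annK]; first by rewrite in_ann scale1r.
have [|Kv0|KvS] := minS (orbit_sub K v).
- by move=> _ /orbit_subP[b _ ->]; apply: rpredZ.
- move=> b; apply/idP/idP => [bK|]; last exact: sub_annK.
  rewrite in_ann -[_ == 0]/(_ \in pred1 0) -Kv0.
  by apply/orbit_subP; exists b.
- have /orbit_subP[b bK vE] : v \in orbit_sub K v by rewrite KvS.
  case/negP: K1; rewrite -[1](subrK b) lidealD //.
  by apply: sub_annK; rewrite in_ann scalerBl scale1r -vE subrr.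
Qed.

End Transporter.

Section JacobsonRadical.
Variable R : nzRingType.

Lemma minimal_quotmod (I : submodClosed R^o) :
  maximal_left_ideal I -> minimal_submod (full_sub (quotmod I)).
Proof.
move=> [I1 maxI] K _; pose piI : {linear R^o -> quotmod I} := \pi_(quotmod I).
have mem_pre (q : quotmod I) : (q \in K) = (repr q \in preim_sub piI K).
  by rewrite in_preim_sub /= reprK.
have [K1|K1] := boolP ((1 : R) \in preim_sub piI K).
  by right=> q; rewrite in_full_sub mem_pre -[repr q]mulr1; apply: lidealM.
left=> q; rewrite mem_pre (maxI _ K1) => [|x xI].
  rewrite inE -{2}[q]reprK -(raddf0 piI); apply/idP/eqP => [qI|/quotmod_eqP].
    by apply/quotmod_eqP; rewrite subr0.
  by rewrite subr0.
rewrite in_preim_sub; suff -> : piI x = piI 0 by rewrite raddf0 rpred0.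
by apply/quotmod_eqP; rewrite subr0.
Qed.

(** The radical, defined by left ideals, is closed under right multiplication
    because it kills the class of r in each simple module R / I. *)
Lemma Jac_mulr (a r : R) : a \in Jac R -> a * r \in Jac R.
Proof.
move=> aJ; apply/asboolP => I maxI.
have := Jac_minimal_submod (minimal_quotmod maxI) aJ (in_full_sub (\pi_(quotmod I) r)).
rewrite -linearZ /= -(raddf0 (\pi_(quotmod I))) => /quotmod_eqP.
by rewrite subr0.
Qed.

(** The vectors sent to Jac^2 M by all of Jac form a submodule, since Jac is a
    two-sided ideal, and this submodule contains the generators of Jac M. *)
Lemma Jac_second_Loewy_layer (M : lmodType R) (a : R) (q : second_Loewy_layer M) :
  a \in Jac R -> a *: q = 0.
Proof.
set J2M := smul (Jac2 R) (predT : {pred M}) => aJ.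
have [x xJ qE] := subquot_surj q.
apply: val_inj; rewrite linearZ /= qE -linearZ /= -(raddf0 (\pi_(quotmod J2M))).
apply/quotmod_eqP; rewrite subr0.
have inX : forall y : M,
    reflect (forall b : R, b \in Jac R -> b *: y \in J2M)
      (y \in lspan (fun y => forall b : R, b \in Jac R -> b *: y \in J2M)).
  apply: lspanP => [b _|c y z yX zX b bJ]; first by rewrite scaler0 rpred0.
  by rewrite scalerDr scalerA rpredD ?yX ?zX ?Jac_mulr.
suff /inX : x \in lspan (fun y => forall b : R, b \in Jac R -> b *: y \in J2M) by apply.
move: x xJ {qE}; apply: lspan_min => _ [c [m [cJ _ ->] ] ]; apply/inX => b bJ.
rewrite scalerA; apply: lspan_gen; exists (b * c), m; split=> //.
by apply: lspan_gen; exists b, c.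
Qed.

End JacobsonRadical.

(** * Modules over a finite-dimensional algebra *)

Section FiniteDimensionalAlgebra.
Variables (F : fieldType) (A : falgType F).
Implicit Types K : submodClosed A^o.

(** A subspace of largest dimension inside K exhausts K. *)
Lemma left_ideal_vspace K : exists U : {vspace A}, forall x, (x \in U) = (x \in K).
Proof.
pose Q m := `[< exists2 U : {vspace A}, {subset U <= K} & \dim U = m >].
have Q0 : exists m, Q m.
  exists 0%N; apply/asboolP; exists 0%VS; rewrite ?dimv0 // => x.
  by rewrite memv0 => /eqP ->; apply: lideal0.
have Qle m : Q m -> (m <= \dim {:A})%N.
  by case/asboolP => U _ <-; apply/dimvS/subvf.
case: (ex_maxnP Q0 Qle) => m /asboolP[U UK <-] maxU.
exists U => x; apply/idP/idP => [|xK]; first exact: UK.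
have : (\dim (U + <[x]>) <= \dim U)%N.
  apply: maxU; apply/asboolP; exists (U + <[x]>)%VS => // t.
  case/memv_addP => y yU [_ /vlineP[c ->] ->].
  apply: lidealD; first exact: UK.
  by rewrite -[x]mul1r scalerAl; apply: lidealM.
move=> dimU; have /eqP UE : U == (U + <[x]>)%VS by rewrite eqEdim addvSl.
by rewrite UE (subvP (addvSr _ _)) ?memv_line.
Qed.

Definition ldim K : nat := \dim (sval (cid (left_ideal_vspace K))).

Lemma ldim_eq K K' : {subset K <= K'} -> (ldim K' <= ldim K)%N -> K' =i K.
Proof.
rewrite /ldim; case: cid => U' UK'; case: cid => U UK /= KK' dimK x.
suff /eqP UU' : U == U' by rewrite -UK -UK' UU'.
by rewrite eqEdim dimK andbT; apply/subvP => y; rewrite UK UK' => /KK'.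
Qed.

(** The semisimplicity of A / Jac A: every left ideal K above the radical has
    a complement K' modulo the radical. Take K' of least dimension with
    K + K' = A. If K and K' share an element a outside the radical, then some
    maximal left ideal I misses a, and since I + A a = A the intersection of
    K' and I still has sum A with K. *)
Lemma Jac_complement K : {subset Jac A <= K} ->
  exists2 K' : submodClosed A^o, exists2 b : A, b \in K & 1 - b \in K' &
    forall x : A, x \in K -> x \in K' -> x \in Jac A.
Proof.
move=> JK.
suff main m K' : (ldim K' < m)%N -> {subset Jac A <= K'} ->
    (exists2 b : A, b \in K & 1 - b \in K') ->
  exists2 K'' : submodClosed A^o, exists2 b : A, b \in K & 1 - b \in K'' &
    forall x : A, x \in K -> x \in K'' -> x \in Jac A.
  apply: (main (ldim (full_sub A^o)).+1 (full_sub A^o)) => //.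
    by move=> x _; apply: in_full_sub.
  by exists 0; [exact: lideal0 | exact: in_full_sub].
elim: m K' => // m IHm K' ltm JK' [b bK cK'].
have [int_ok|/existsNP[a] ] :=
    pselect (forall x : A, x \in K -> x \in K' -> x \in Jac A).
  by exists K' => //; exists b.
move=> /not_implyP[aK] /not_implyP[aK' aJ].
have /existsNP[I /not_implyP[ [I1 maxI] aI] ] :
  ~ forall I : submodClosed A^o, maximal_left_ideal I -> a \in I.
  by move=> allI; apply: aJ; apply/asboolP.
(* By maximality of I the left ideal I + A a contains 1. *)
have [r rI] : exists r : A, 1 - r * a \in I.
  pose N : submodClosed A^o :=
    lspan (fun x : A^o => exists r : A, x - r * a \in I).
  have inN x : reflect (exists r : A, x - r * a \in I) (x \in N).
    apply: lspanP; first by exists 0; rewrite mul0r subr0 lideal0.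
    move=> t v w [r1 v1] [r2 w2]; exists (t * r1 + r2).
    by rewrite mulrDl opprD addrACA lidealD // -mulrA -mulrBr lidealM.
  apply/inN; case: (boolP (_ \in _)) => // N1.
  case: aI; rewrite -(maxI N N1) => [|x xI]; apply/inN.
    by exists 1; rewrite mul1r subrr lideal0.
  by exists 0; rewrite mul0r subr0.
pose K'' : submodClosed A^o := lspan (fun x : A^o => x \in K' /\ x \in I).
have inK'' x : reflect (x \in K' /\ x \in I) (x \in K'').
  apply: lspanP; first by rewrite !rpred0.
  by move=> t v w [v1 v2] [w1 w2]; rewrite !rpredD ?rpredZ.
have subK'' : {subset K'' <= K'} by move=> x /inK''[].
apply: (IHm K'').
- rewrite -ltnS; apply: leq_trans ltm; rewrite ltnS ltnNge; apply/negP => ledim.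
  have := ldim_eq subK'' ledim a; rewrite aK' => /esym/inK''[_].
  exact: aI.
- by move=> x xJ; apply/inK''; split; [exact: JK' | move/asboolP: xJ; apply].
have craK (N : submodClosed A^o) : a \in N -> (1 - b) * r * a \in N.
  exact: lidealM.
(* 1 - b lies in K', and (1 - b) r a in both K and K'; as 1 - r a lies in I,
   the difference (1 - b) (1 - r a) lies in K' and in I. *)
exists (b + (1 - b) * r * a); first by rewrite lidealD ?craK.
rewrite opprD addrA; apply/inK''; split; first by rewrite lidealB ?craK.
rewrite -[X in X - _]mulr1 -mulrA -mulrBr.
exact: lidealM.
Qed.

(** A cyclic module killed by the radical is semisimple, so phi has a section
    over the submodule generated by phi m; such a section amounts to a
    preimage q of phi m with the annihilator of phi m. It is obtained by
    multiplying m by the component of 1 in a complement of that annihilator. *)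
Lemma cyclic_lift (M N : lmodType A) (phi : {linear M -> N}) (m : M) :
    (forall a : A, a \in Jac A -> a *: m = 0) ->
  exists2 q, phi q = phi m & forall a : A, a *: phi q = 0 -> a *: q = 0.
Proof.
move=> Jm; have [a aJ|K' [b bK cK'] KK'] := @Jac_complement (ann (phi m)).
  by rewrite in_ann -linearZ Jm ?raddf0.
have phiq : phi ((1 - b) *: m) = phi m.
  move: bK; rewrite in_ann => /eqP bK.
  by rewrite linearZ /= scalerBl scale1r bK subr0.
exists ((1 - b) *: m) => // a aq.
rewrite scalerA Jm // KK' //; last exact: lidealM.
by rewrite in_ann -scalerA -linearZ aq.
Qed.

End FiniteDimensionalAlgebra.

Section CyclicModule.
Variables (F : fieldType) (A : falgType F) (P : lmodType A) (w : P).
Hypothesis gen_w : forall x, exists a : A, x = a *: w.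

(** In a cyclic module A w, a submodule is determined by the left ideal of the
    coefficients that send w into it, so the dimension of that ideal is a rank. *)
Lemma cyclic_rank_lt (X Y : submodClosed P) : {subset X <= Y} ->
  (exists2 x, x \in Y & x \notin X) -> (ldim (colon X w) < ldim (colon Y w))%N.
Proof.
move=> sXY [x xY xX]; rewrite ltnNge; apply/negP => le_dim; case/negP: xX.
have [a xE] := gen_w x; rewrite xE -in_colon.
have sub : {subset colon X w <= colon Y w} by move=> b; rewrite !in_colon => /sXY.
by rewrite -(ldim_eq sub le_dim) in_colon -xE.
Qed.

End CyclicModule.

(** * The algebra of linear endomorphisms *)

Section LinearEndomorphisms.
Variables (F : fieldType) (V : lmodType F).

Definition linear_sub : submodClosed (V -> V) :=
  lspan (fun f : V -> V => linear f).

Lemma linear_subP (f : V -> V) : reflect (linear f) (f \in linear_sub).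
Proof.
apply: lspanP => [a v w|a g h lin_g lin_h b v w] /=; first by rewrite scaler0 addr0.
rewrite -[LHS]/(a *: g (b *: v + w) + h (b *: v + w)).
rewrite -[RHS]/(b *: (a *: g v + h v) + (a *: g w + h w)).
by rewrite lin_g lin_h !scalerDr !scalerA [b * a]mulrC addrACA.
Qed.

Variables (v0 : V) (v0_neq0 : v0 != 0).

(** The endomorphism algebra of a space of arbitrary dimension. A nonzero
    vector is recorded in the type because algebras have 1 != 0. *)
Definition endo of v0 != 0 : Type := submod linear_sub.
Local Notation endoV := (endo v0_neq0).
HB.instance Definition _ := GRing.Lmodule.on endoV.

Definition endo_fun (f : endoV) : V -> V := sval f.
Definition to_endo (f : V -> V) (lin_f : linear f) : endoV :=
  exist (fun g => g \in linear_sub) f (introT (linear_subP f) lin_f).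

Lemma endo_linear (f : endoV) : linear (endo_fun f).
Proof. exact/linear_subP/(valP f). Qed.
HB.instance Definition _ (f : endoV) :=
  GRing.isLinear.Build F V V *:%R (endo_fun f) (endo_linear f).

Lemma endoP (f g : endoV) : endo_fun f =1 endo_fun g -> f = g.
Proof. by move=> /funext eq_fg; apply: val_inj. Qed.

Lemma endoD (f g : endoV) v : endo_fun (f + g) v = endo_fun f v + endo_fun g v.
Proof. by []. Qed.

Lemma endoN (f : endoV) v : endo_fun (- f) v = - endo_fun f v.
Proof. by []. Qed.

Lemma endoZ a (f : endoV) v : endo_fun (a *: f) v = a *: endo_fun f v.
Proof. by []. Qed.

Fact comp_linear (f g : endoV) : linear (endo_fun f \o endo_fun g).
Proof. by move=> a v w; rewrite /= !linearP. Qed.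
Definition endo_mul (f g : endoV) : endoV := to_endo (comp_linear f g).

Fact id_linear : linear (@id V). Proof. by []. Qed.
Definition endo_one : endoV := to_endo id_linear.

Fact endo_mulA : associative endo_mul. Proof. by move=> f g h; apply: endoP. Qed.
Fact endo_mul1r : left_id endo_one endo_mul. Proof. by move=> f; apply: endoP. Qed.
Fact endo_mulr1 : right_id endo_one endo_mul. Proof. by move=> f; apply: endoP. Qed.
Fact endo_mulDl : left_distributive endo_mul +%R.
Proof. by move=> f g h; apply: endoP. Qed.
Fact endo_mulDr : right_distributive endo_mul +%R.
Proof. by move=> f g h; apply: endoP => v; apply: (raddfD (endo_fun f)). Qed.
Fact endo_one_neq0 : endo_one != 0.
Proof.
by apply: contraNneq v0_neq0 => /(congr1 (fun f : endoV => endo_fun f v0)) /= ->.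
Qed.

HB.instance Definition _ := GRing.Zmodule_isNzRing.Build endoV
  endo_mulA endo_mul1r endo_mulr1 endo_mulDl endo_mulDr endo_one_neq0.

Fact endo_scalerAl a (f g : endoV) : a *: (f * g) = (a *: f) * g.
Proof. exact: endoP. Qed.
HB.instance Definition _ := GRing.Lmodule_isLalgebra.Build F endoV endo_scalerAl.
Fact endo_scalerAr a (f g : endoV) : a *: (f * g) = f * (a *: g).
Proof. by apply: endoP => v; rewrite -[RHS]/(endo_fun f (a *: endo_fun g v)) linearZ. Qed.
HB.instance Definition _ := GRing.Lalgebra_isAlgebra.Build F endoV endo_scalerAr.

Lemma endoM (f g : endoV) v : endo_fun (f * g) v = endo_fun f (endo_fun g v).
Proof. by []. Qed.

Lemma endoX (f : endoV) n v : endo_fun (f ^+ n) v = iter n (endo_fun f) v.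
Proof. by elim: n => // n IHn; rewrite exprS endoM IHn. Qed.

End LinearEndomorphisms.

(** Left and right multiplication by a are commuting endomorphisms of A, so
    the p-th power of their difference is the difference of the p-th powers. *)
Lemma commutator_iter (F : fieldType) (p : nat) (A : algType F) (a b : A) :
  p \in [pchar F] -> iter p (fun c => a * c - c * a) b = a ^+ p * b - b * a ^+ p.
Proof.
move=> charF; pose E := endo (oner_neq0 A).
have lin_l (c : A) : linear (fun d : A => c * d).
  by move=> k d e; rewrite mulrDr scalerAr.
have lin_r (c : A) : linear (fun d : A => d * c).
  by move=> k d e; rewrite mulrDl scalerAl.
pose l : E := to_endo _ (lin_l a); pose r : E := to_endo _ (lin_r a).
have charE : p \in [pchar E].
  by apply: (rmorph_pchar (in_alg E)); exact: charF.
have comm_lr : GRing.comm l r by apply: endoP => c; apply: mulrA.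
have powl n c : endo_fun (l ^+ n) c = a ^+ n * c.
  by rewrite endoX; elim: n => [|n IHn] /=; rewrite ?mul1r // IHn exprS mulrA.
have powr n c : endo_fun (r ^+ n) c = c * a ^+ n.
  by rewrite endoX; elim: n => [|n IHn] /=; rewrite ?mulr1 // IHn exprSr mulrA.
have frob : (l - r) ^+ p = l ^+ p - r ^+ p.
  by have := pFrobenius_autB_comm charE comm_lr; rewrite !pFrobenius_autE.
by rewrite -powl -powr -endoN -endoD -frob endoX.
Qed.

(** * Modules over the restricted enveloping algebra *)

Section Generation.
Variables (F : fieldType) (p : nat) (L : restrictedLieType F p).
Variable u : restrictedEnvelope L.
Variable B : u -> Prop.
Hypotheses (B1 : B 1) (BD : forall a b, B a -> B b -> B (a + b)).
Hypotheses (BM : forall a b, B a -> B b -> B (a * b)).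
Hypotheses (BZ : forall (c : F) a, B a -> B (c *: a)).

Let Bb : {pred u} := fun a => `[< B a >].

Fact Bb_closed : GRing.subsemialg_closed Bb.
Proof.
have B0 : B 0 by rewrite -(scale0r 1); apply: BZ.
split; first exact/asboolP.
- split; [exact/asboolP | move=> a b /asboolP Ba /asboolP Bb'; exact/asboolP/BD].
- by move=> c a /asboolP Ba; apply/asboolP/BZ.
by move=> a b /asboolP Ba /asboolP Bb'; apply/asboolP/BM.
Qed.

Let Bs : Type := {a : u | a \in Bb}.
HB.instance Definition _ := SubChoice.on Bs.
HB.instance Definition _ :=
  GRing.SubChoice_isSubAlgebra.Build F u Bb Bs Bb_closed.

Let incl : Bs -> u := \val.
HB.instance Definition _ := GRing.RMorphism.copy incl (\val : Bs -> u).
HB.instance Definition _ := GRing.Linear.copy incl (\val : Bs -> u).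

(** The image of L generates u(L) as an algebra. A subalgebra containing that
    image receives a morphism from u(L), and composed with the inclusion it
    agrees with the identity on L, hence everywhere. *)
Lemma env_ind : (forall x, B (env_in u x)) -> forall a, B a.
Proof.
move=> BL a; have [lin br pw] := env_in_morph u.
have BLb x : env_in u x \in Bb by apply/asboolP.
pose f x : Bs := exist (fun a => a \in Bb) (env_in u x) (BLb x).
have fM : restricted_morphism f.
  split=> [c x y|x y|x]; apply: val_inj; rewrite ?rmorphXn /=.
  - exact: lin.
  - exact: br.
  - exact: pw.
have [g gf _] := env_universal u fM.
have [h _ h_uniq] := env_universal u (env_in_morph u).
have e1 := h_uniq (incl \o g).
have e2 := h_uniq (@idfun u).
have -> : a = val (g a) by rewrite -[LHS]/(idfun a) e2 // -e1 // => x /=; rewrite gf.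
exact/asboolP/(valP (g a)).
Qed.

End Generation.

Section RepresentationModule.
Variables (F : fieldType) (A : algType F) (V : lmodType F) (v0 : V).
Variables (v0_neq0 : v0 != 0) (g : {lrmorphism A -> endo v0_neq0}).

Definition rep_mod of {lrmorphism A -> endo v0_neq0} : Type := V.
Local Notation M := (rep_mod g).
HB.instance Definition _ := GRing.Zmodule.copy M V.

Definition rep_scale (a : A) (v : M) : M := endo_fun (g a) v.

Fact rep_scalerA a b v : rep_scale a (rep_scale b v) = rep_scale (a * b) v.
Proof. by rewrite /rep_scale rmorphM. Qed.
Fact rep_scale1r : left_id 1 rep_scale.
Proof. by move=> v; rewrite /rep_scale rmorph1. Qed.
Fact rep_scalerDr : right_distributive rep_scale +%R.
Proof. by move=> a v w; apply: (raddfD (endo_fun (g a))). Qed.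
Fact rep_scalerDl v : {morph rep_scale^~ v : a b / a + b}.
Proof. by move=> a b; rewrite /rep_scale raddfD. Qed.

HB.instance Definition _ := GRing.Zmodule_isLmodule.Build A M
  rep_scalerA rep_scale1r rep_scalerDr rep_scalerDl.

End RepresentationModule.

Section LieHomomorphisms.
Variables (F : fieldType) (L : lieAlgType F).

(** Isomorphisms are produced by comparing two embeddings in a third module. *)
Lemma lie_module_iso_of_images (M N W : lieModType L) (f : M -> W) (g : N -> W) :
    lie_module_hom f -> lie_module_hom g -> injective f -> injective g ->
    (forall x, exists y, g y = f x) -> (forall y, exists x, f x = g y) ->
  lie_module_iso M N.
Proof.
move=> [lin_f act_f] [lin_g act_g] inj_f inj_g im_f im_g.
pose s x := sval (cid (im_f x)); pose t y := sval (cid (im_g y)).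
have gs x : g (s x) = f x by rewrite /s; case: cid.
have ft y : f (t y) = g y by rewrite /t; case: cid.
exists s; last by exists t => [x|y]; [apply: inj_f | apply: inj_g]; rewrite ?ft gs ?ft.
split=> [a x y|x v]; apply: inj_g; first by rewrite lin_g !gs lin_f.
by rewrite act_g !gs act_f.
Qed.

End LieHomomorphisms.

Section IrreducibleModules.
Variables (F : fieldType) (L : lieAlgType F) (S : lieModType L).

Definition lie_irreducible : Prop :=
  (exists v : S, v != 0) /\
  forall K : submodClosed S,
    (forall (x : L) v, v \in K -> lact x v \in K) -> K =i pred1 0 \/ K =i predT.

(** The line through a nonzero invariant vector is a submodule, hence the
    whole module, and L acts on it by zero. *)
Lemma irreducible_invariants : lie_irreducible ->
  ~ lie_module_iso S (trivmod L) -> forall v : S, (forall x : L, lact x v = 0) -> v = 0.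
Proof.
move=> [_ S_irr] nontriv v v_inv; apply: contrapT => /eqP v_neq0; apply: nontriv.
have actZ (a : F) (x : L) : lact x (a *: v) = 0 by rewrite lactZr v_inv scaler0.
have inX : forall w : S, reflect (exists a : F, w = a *: v)
    (w \in lspan (fun w => exists a : F, w = a *: v)).
  apply: lspanP => [|a _ _ [b ->] [c ->] ]; first by exists 0; rewrite scale0r.
  by exists (a * b + c); rewrite scalerDl scalerA.
have [x _ /inX[a ->]|K0|KT] :=
  S_irr (lspan (fun w => exists a : F, w = a *: v)).
- by rewrite actZ rpred0.
- have : v \in lspan (fun w => exists a : F, w = a *: v).
    by apply/inX; exists 1; rewrite scale1r.
  by rewrite K0 inE (negPf v_neq0).
have line w : exists a : F, w = a *: v by apply/inX; rewrite KT.
apply: (@lie_module_iso_of_images F L S (trivmod L) S id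
  (fun a : trivmod L => (a : F) *: v)) => //.
- split=> [a b c|x a]; first by rewrite scalerDl scalerA.
  by rewrite scale0r actZ.
- move=> a b /eqP; rewrite -subr_eq0 -scalerBl scaler_eq0 (negPf v_neq0) orbF.
  by rewrite subr_eq0 => /eqP.
- by move=> w; have [a ->] := line w; exists a.
by move=> a; exists ((a : F) *: v).
Qed.

End IrreducibleModules.

Section EnvelopeHomomorphisms.
Variables (F : fieldType) (p : nat) (L : restrictedLieType F p).
Variable u : restrictedEnvelope L.

Lemma env_linear_hom (M N : lmodType u) (f : {linear M -> N}) :
  @lie_module_hom F L (env_mod M) (env_mod N) f.
Proof.
split=> [a x y|x v]; last by rewrite -[LHS]/(f (env_in u x *: (v : M))) linearZ.
by rewrite -[LHS]/(f ((a%:A : u) *: (x : M) + (y : M))) linearP.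
Qed.

(** A simple submodule N of W in the image of P is the quotient of its
    preimage by the kernel, and a composition series of the cyclic module P
    can be drawn through these two submodules. The module S, which is not a
    module over u(L) by construction, is identified with N through iota. *)
Lemma composition_factor_preim (P W : lmodType u) (w : P) (h : {linear P -> W})
    (N : submodClosed W) (S : lieModType L) (iota : S -> env_mod W) :
    (forall x, exists a : u, x = a *: w) ->
    minimal_submod N -> (exists2 y, y \in N & y != 0) ->
    {subset N <= image_sub h (full_sub P)} ->
    lie_module_hom iota -> injective iota ->
    (forall y : W, y \in N <-> exists v, iota v = y) ->
  composition_factor S P.
Proof.
move=> gen_w minN N0 N_im hom_i inj_i im_i.
have cov := covers_preim_sub minN N0 N_im.
have [n [C [serC [j ltjn [Cj CSj] ] ] ] ] :=
  composition_series_through (cyclic_rank_lt gen_w) cov.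
exists n, C; split=> //; exists j => //.
have hC x : x \in C j -> h x = 0 by rewrite Cj in_ker_sub => /eqP.
pose phi : {linear subquot (C j) (C j.+1) -> W} :=
  HB.pack (@subquot_map _ _ _ h (C j) (C j.+1))
    (GRing.isLinear.Build _ _ _ _ _ (subquot_map_linear hC)).
apply: (lie_module_iso_of_images hom_i (env_linear_hom phi)) => //.
- move=> q r; have [x xC qE] := subquot_surj q; have [y yC rE] := subquot_surj r.
  rewrite /= (subquot_mapE hC qE) (subquot_mapE hC rE) => hxy.
  apply: val_inj; rewrite qE rE; apply/quotmod_eqP.
  by rewrite Cj in_ker_sub raddfB subr_eq0; apply/eqP.
- move=> v; have vN : (iota v : W) \in N by apply/im_i; exists v.
  have /image_subP[x _ vE] := N_im _ vN.
  have [|q qE] := @subquot_lift _ _ (C j) (C j.+1) x.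
    by rewrite CSj in_preim_sub -vE.
  by exists q; rewrite /= (subquot_mapE hC qE).
move=> q; have [x xC qE] := subquot_surj q.
rewrite /= (subquot_mapE hC qE); apply/im_i.
by move: xC; rewrite CSj in_preim_sub.
Qed.

(** Semisimplicity of M is used only for the submodule generated by one lift q
    of a nonzero y0 in N: as q has the annihilator of y0, sending a y0 to a q
    is a section of phi over N = u y0. *)
Lemma direct_summand_minimal_quotient (M W : lmodType u) (phi : {linear M -> W})
    (N : submodClosed W) (S : lieModType L) (iota : S -> env_mod W) :
    (forall (a : u) (m : M), a \in Jac u -> a *: m = 0) ->
    minimal_submod N -> (exists2 y, y \in N & y != 0) ->
    (forall m, phi m \in N) -> {subset N <= image_sub phi (full_sub M)} ->
    lie_module_hom iota -> injective iota ->
    (forall y : W, y \in N <-> exists v, iota v = y) ->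
  direct_summand S (env_mod M).
Proof.
move=> JM minN [y0 y0N y0_neq0] phi_N N_im [lin act] inj_i im_i.
have /image_subP[q0 _ y0E] := N_im y0 y0N.
have [q phi_q ann_q] := cyclic_lift phi (fun a aJ => JM a q0 aJ).
have {q0 y0E}phi_q : phi q = y0 by rewrite phi_q.
have gen v : exists a : u, a *: phi q = iota v.
  have [|N0|NE] := minN (orbit_sub (full_sub u^o) (phi q)).
  - by move=> _ /orbit_subP[a _ ->]; rewrite rpredZ // phi_N.
  - have : phi q \in orbit_sub (full_sub u^o) (phi q).
      by apply/orbit_subP; exists 1; [exact: in_full_sub | rewrite scale1r].
    by rewrite N0 phi_q inE (negPf y0_neq0).
  have : (iota v : W) \in N by apply/im_i; exists v.
  by rewrite -NE => /orbit_subP[a _ ->]; exists a.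
pose sec v : M := sval (cid (gen v)) *: q.
(* By the choice of q, the value of sec does not depend on the coefficient a
   used to write iota v as a (phi q). *)
have secE v (a : u) : a *: phi q = iota v -> sec v = a *: q.
  rewrite /sec; case: cid => b /= bE aE; apply/eqP.
  by rewrite -subr_eq0 -scalerBl ann_q // scalerBl aE bE subrr.
have phi_sec v : phi (sec v) = iota v.
  by have [a aE] := gen v; rewrite (secE v a aE) -aE linearZ.
have sec_hom : @lie_module_hom F L S (env_mod M) sec.
  split=> [c v v'|x v].
    rewrite -[RHS]/((c%:A : u) *: sec v + sec v' : M).
    have [a aE] := gen v; have [b bE] := gen v'.
    rewrite (secE v a aE) (secE v' b bE) scalerA -scalerDl; apply: secE.
    by rewrite scalerDl -scalerA aE bE lin.
  have [a aE] := gen v.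
  rewrite -[RHS]/(env_in u x *: sec v : M).
  by rewrite (secE v a aE) scalerA; apply: secE; rewrite -scalerA aE act.
have coord_ex m : exists v, iota v = phi m by apply/im_i.
pose coord m := sval (cid (coord_ex m)).
have coordE m : iota (coord m) = phi m by rewrite /coord; case: cid.
pose K := ker_sub phi.
have diffK m : m - sec (coord m) \in K.
  rewrite in_ker_sub raddfB subr_eq0; apply/eqP.
  exact: etrans (esym (coordE m)) (esym (phi_sec _)).
pose C : lieModType L := env_mod (submod K).
pose emb (c : C) : env_mod M := \val (c : submod K).
exists C, sec, emb; split=> //.
pose inv (m : env_mod M) : S * C :=
  (coord m, exist (fun y => y \in K) _ (diffK m)).
exists inv => [ [v c]|m]; last by rewrite /= addrC subrK.
have phi_c : phi (emb c : M) = 0.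
  by apply/eqP; rewrite -in_ker_sub; apply: (valP (c : submod K)).
have coord_v : coord ((sec v : M) + (emb c : M)) = v.
  apply: inj_i; rewrite coordE.
  have -> : phi ((sec v : M) + (emb c : M)) = phi (sec v) + phi (emb c) :=
    raddfD phi _ _.
  by rewrite phi_c addr0 phi_sec.
by congr (_, _) => //=; apply: val_inj; rewrite /= coord_v addrC addKr.
Qed.

End EnvelopeHomomorphisms.

(** * The extension of the trivial module defined by a derivation *)

Section Extension.
Variables (F : fieldType) (p : nat) (charF : p \in [pchar F]).
Variables (L : restrictedLieType F p) (u : restrictedEnvelope L).
Variables (S : lieModType L) (D : L -> S).
Hypothesis S_restricted : forall (x : L) (v : S), lact (ppow x) v = iter p (lact x) v.
Hypothesis S_irreducible : lie_irreducible S.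
Hypothesis S_invariants : forall v : S, (forall x : L, lact x v = 0) -> v = 0.
Hypothesis D_linear : linear D.
Hypothesis D_derivation :
  forall x y : L, D [[x, y]] = lact x (D y) - lact y (D x).
Hypothesis D_outer : forall v : S, ~ forall x : L, D x = lact x v.

Let E0 : lmodType F := (S * F^o)%type.
Let e0 : E0 := (0, 1).
Fact e0_neq0 : e0 != 0.
Proof. by rewrite xpair_eqE oner_eq0 andbF. Qed.

(** The action of L on the extension E of the trivial module by S, the second
    coordinate being the projection to the trivial module. *)
Definition ext_act (x : L) (e : E0) : E0 := (lact x e.1 + (e.2 : F) *: D x, 0).

Fact ext_act_linear x : linear (ext_act x).
Proof.
move=> c [v a] [w b]; congr (_, _) => /=; last by rewrite scaler0 addr0.
by rewrite lactDr lactZr scalerDl scalerDr addrACA scalerA.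
Qed.

Definition ext_rep (x : L) : endo e0_neq0 := to_endo e0_neq0 (ext_act_linear x).

Fact ext_rep_linear : linear ext_rep.
Proof.
move=> c x y; apply: endoP => -[v a]; rewrite endoD endoZ; congr (_, _) => /=.
  by rewrite lactDl lactZl D_linear scalerDr scalerDr addrACA !scalerA mulrC.
by rewrite scaler0 addr0.
Qed.

Fact ext_rep_bracket x y :
  ext_rep [[x, y]] = ext_rep x * ext_rep y - ext_rep y * ext_rep x.
Proof.
apply: endoP => -[v a]; rewrite endoD endoN !endoM; congr (_, _) => /=; last first.
  by rewrite subr0.
rewrite !scale0r !addr0 lact_bracket D_derivation scalerBr !lactDr !lactZr.
by rewrite opprD addrACA.
Qed.

Lemma iter_ext_act n x v (a : F) :
  iter n.+1 (ext_act x) (v, a) =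
    (iter n.+1 (lact x) v + a *: iter n (lact x) (D x), 0).
Proof.
elim: n => [//|n IHn]; rewrite iterS IHn; congr (_, _).
by rewrite /= scale0r addr0 lactDr lactZr.
Qed.

(** The difference of both sides maps (v, a) to (a z, 0) for a fixed z in S,
    and it commutes with the action of L, because both sides have the same
    commutator with it. As L maps (0, 1) into S, where the difference is zero,
    the vector z is invariant, hence zero. *)
Fact ext_rep_ppow x : ext_rep (ppow x) = ext_rep x ^+ p.
Proof.
have p_gt0 : (0 < p)%N := prime_gt0 (pcharf_prime charF).
pose z := D (ppow x) - iter p.-1 (lact x) (D x).
have diff v (a : F) : endo_fun (ext_rep (ppow x) - ext_rep x ^+ p) (v, a) = (a *: z, 0).
  have := iter_ext_act p.-1 x v a; rewrite (prednK p_gt0) => iter_p.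
  rewrite endoD endoN endoX [iter _ _ _]iter_p.
  congr (_, _) => /=; last by rewrite subr0.
  by rewrite S_restricted opprD addrACA subrr add0r -scalerBr.
have comm y : ext_rep y * (ext_rep (ppow x) - ext_rep x ^+ p) =
              (ext_rep (ppow x) - ext_rep x ^+ p) * ext_rep y.
  have ad_pow : iter p (fun c => ext_rep x * c - c * ext_rep x) (ext_rep y) =
                ext_rep (ppow x) * ext_rep y - ext_rep y * ext_rep (ppow x).
    rewrite -ext_rep_bracket ppow_ad.
    have iterE n : iter n (fun c => ext_rep x * c - c * ext_rep x) (ext_rep y) =
                   ext_rep (iter n (bracket x) y).
      by elim: n => //= n ->; rewrite ext_rep_bracket.
    exact: iterE.
  move: ad_pow; rewrite commutator_iter // mulrBr mulrBl => eq_xy.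
  apply: (addrI (ext_rep x ^+ p * ext_rep y)).
  by rewrite addrCA eq_xy ![_ + (_ - _)]addrC !subrK.
have z0 : z = 0.
  apply: S_invariants => y; have := congr1 (fun f => endo_fun f e0) (comm y).
  rewrite !endoM diff scale1r [endo_fun (ext_rep y) e0]surjective_pairing diff.
  by case; rewrite !scale0r !addr0.
apply/eqP; rewrite -subr_eq0; apply/eqP/endoP => -[v a].
by rewrite diff z0 scaler0.
Qed.

Lemma ext_rep_morphism : restricted_morphism ext_rep.
Proof.
by split; [exact: ext_rep_linear | exact: ext_rep_bracket | exact: ext_rep_ppow].
Qed.

Variables (g : {lrmorphism u -> endo e0_neq0}).
Hypothesis g_in : forall x, g (env_in u x) = ext_rep x.

Let E : lmodType u := rep_mod g.

Lemma ext_in (x : L) (e : E) : env_in u x *: e = ext_act x e :> E0.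
Proof. by rewrite -[LHS]/(endo_fun (g (env_in u x)) e) g_in. Qed.

Lemma ext_scale (c : F) (e : E) : (c%:A : u) *: e = c *: (e : E0) :> E0.
Proof. by rewrite -[LHS]/(endo_fun (g c%:A) e) linearZ /= rmorph1. Qed.

Lemma ext_inclP (c : F) (v v' : S) :
  (c *: v + v', 0) = (c%:A : u) *: ((v, 0) : E) + ((v', 0) : E) :> E.
Proof.
rewrite [(c%:A : u) *: _]ext_scale -[RHS]/((c *: v + v', c *: 0 + 0) : E0).
by rewrite scaler0 addr0.
Qed.

Variables (T P : lmodType u) (t0 : T) (pi : {linear P -> T}).
Hypothesis t0_neq0 : t0 != 0.
Hypothesis T_line : forall t, exists c : F, t = (c%:A : u) *: t0.
Hypothesis T_trivial : forall (x : L) (t : T), env_in u x *: t = 0.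

Lemma alg_scalerA (M : lmodType u) (a b : F) (v : M) :
  ((a * b)%:A : u) *: v = (a%:A : u) *: ((b%:A : u) *: v).
Proof. by rewrite [RHS]scalerA mulr_algl scalerA. Qed.

Lemma minimal_trivial : minimal_submod (full_sub T).
Proof.
move=> K _; have [K0|/existsNP[t /not_implyP[tK /eqP t_neq0] ] ] :=
  pselect (forall t, t \in K -> t = 0).
  by left=> t; rewrite inE; apply/idP/eqP => [/K0//|->]; apply: rpred0.
right=> s; rewrite in_full_sub; move: tK t_neq0.
have [c ->] := T_line t; have [d ->] := T_line s => cK c_neq0.
have {}c_neq0 : c != 0.
  by apply: contraNneq c_neq0 => ->; rewrite scale0r scale0r.
by rewrite -[d](divfK c_neq0) alg_scalerA rpredZ.
Qed.

Definition ext_proj (e : E) : T := (((e : E0).2 : F)%:A : u) *: t0.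

Fact ext_proj_zmod : zmod_morphism ext_proj.
Proof. by move=> e f; rewrite /ext_proj !scalerBl. Qed.

Fact ext_projD (e f : E) : ext_proj (e + f) = ext_proj e + ext_proj f.
Proof. by rewrite /ext_proj -!scalerDl. Qed.

Fact ext_projZ (c : F) (e : E) :
  ext_proj ((c%:A : u) *: e) = (c%:A : u) *: ext_proj e.
Proof. by rewrite /ext_proj -alg_scalerA [_ *: e]ext_scale. Qed.

(** Linearity over u(L) follows from compatibility with the action of L, which
    is zero on T and has values in S x 0 on E. *)
Fact ext_proj_scale (a : u) (e : E) : ext_proj (a *: e) = a *: ext_proj e.
Proof.
move: a e; apply: (env_ind (B := fun a => forall e, ext_proj (a *: e) = a *: ext_proj e)).
- by move=> e; rewrite !scale1r.
- by move=> a b aP bP e; rewrite !scalerDl -aP -bP -ext_projD.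
- by move=> a b aP bP e; rewrite -!scalerA aP bP.
- by move=> c a aP e; rewrite -[c *: a]mulr_algl -!scalerA -aP ext_projZ.
by move=> x e; rewrite T_trivial /ext_proj [_ *: e]ext_in /= !scale0r.
Qed.

HB.instance Definition _ := GRing.isZmodMorphism.Build E T ext_proj ext_proj_zmod.
HB.instance Definition _ := GRing.isScalable.Build u E T *:%R ext_proj ext_proj_scale.

Let ker : submodClosed E := ker_sub ext_proj.

Lemma in_ker (v : S) (c : F) : (((v, c) : E) \in ker) = (c == 0).
Proof.
transitivity ((c%:A : u) *: t0 == 0); first by rewrite in_ker_sub.
apply/eqP/eqP => [|->]; last by rewrite !scale0r.
move=> cT0; apply/eqP; apply: contraNT t0_neq0 => c_neq0.
rewrite -[t0]scale1r -[1](scale1r (1 : u)) -(mulVf c_neq0) alg_scalerA.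
by rewrite cT0 scaler0.
Qed.

Lemma minimal_ker : minimal_submod ker.
Proof.
move=> K sKk.
pose X (v : S) := ((v, 0) : E) \in K.
have inX : forall v, reflect (X v) (v \in lspan X).
  apply: lspanP => [|a v w vK wK]; first exact: rpred0.
  by rewrite /X ext_inclP rpredD // rpredZ.
have eE (e : E) : e \in ker -> e = (((e : E0).1, 0) : E).
  by case: e => v c; rewrite in_ker /= => /eqP ->.
have [x v /inX vK|K0|KT] := S_irreducible.2 (lspan X).
- apply/inX; have := rpredZ (env_in u x) vK; rewrite /X.
  by rewrite [_ *: _]ext_in /ext_act /= scale0r addr0.
- left=> e; apply/idP/idP => [eK|]; last by rewrite inE => /eqP ->; apply: rpred0.
  have := eK; rewrite (eE e (sKk e eK)) => /inX; rewrite K0 !inE => /eqP ->.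
  exact: eqxx.
right=> e; apply/idP/idP => [/sKk//|/eE ->].
by apply/inX; rewrite KT.
Qed.

Lemma ext_lift : projective P ->
  exists h : {linear P -> E}, forall x, ext_proj (h x) = pi x.
Proof.
move=> /(_ E T ext_proj pi); apply=> t; have [c ->] := T_line t.
by exists ((0, c) : E).
Qed.

Variables (h : {linear P -> E}) (w : P).
Hypotheses (h_pi : forall x, ext_proj (h x) = pi x) (pi_w : pi w = t0).

Local Notation JP := (smul (Jac u) (predT : {pred P})).
Local Notation J2P := (smul (Jac2 u) (predT : {pred P})).

Lemma Jac_ker (a : u) (e : E) : a \in Jac u -> a *: e \in ker.
Proof.
move=> aJ; rewrite in_ker_sub linearZ /=.
by rewrite (Jac_minimal_submod minimal_trivial) ?in_full_sub.
Qed.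

Lemma lift_JP x : x \in JP -> h x \in ker.
Proof.
rewrite -in_preim_sub; move: x; apply: lspan_min => _ [a [v [aJ _ ->] ] ].
by rewrite in_preim_sub linearZ; apply: Jac_ker.
Qed.

(** One factor of the radical carries E into S, the other one kills S. *)
Lemma lift_J2P x : x \in J2P -> h x = 0.
Proof.
suff sub : {subset J2P <= ker_sub h} by move/sub; rewrite in_ker_sub => /eqP.
apply: lspan_min => _ [a [v [aJ2 _ ->] ] ]; rewrite -in_colon.
apply: lspan_min a aJ2 => _ [b [c [bJ cJ ->] ] ]; rewrite in_colon in_ker_sub.
rewrite -[b *: c]/(b * c) -scalerA !linearZ /=.
by rewrite (Jac_minimal_submod minimal_ker) // Jac_ker.
Qed.

(** This is where the extension fails to split: if the radical killed h w,
    then some q in E over t0 would be annihilated by all that annihilates t0,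
    in particular by L. For q = (v, 1) this says that D x = x (- v). *)
Lemma lift_JP_neq0 : exists2 x, x \in JP & h x != 0.
Proof.
have [ [a [aJ ahw] ]|noa] := pselect (exists a : u, a \in Jac u /\ a *: h w != 0).
  exists (a *: w); last by rewrite linearZ.
  by apply: lspan_gen; exists a, w.
have Jhw (a : u) : a \in Jac u -> a *: h w = 0.
  by move=> aJ; apply: contrapT => /eqP ahw; apply: noa; exists a.
have [q psi_q ann_q] := cyclic_lift ext_proj Jhw.
have q_t0 : ext_proj q = t0 := etrans psi_q (etrans (h_pi w) pi_w).
case: (@D_outer (- (q : E0).1)) => x.
have := ann_q (env_in u x) (T_trivial x _); rewrite [LHS]ext_in => -[].
have -> : (q : E0).2 = 1.
  apply/eqP; rewrite -subr_eq0 -(in_ker 0) in_ker_sub.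
  apply/eqP; rewrite -[LHS]/((((q : E0).2 - 1 : F)%:A : u) *: t0) !scalerBl !scale1r.
  by rewrite -[X in X - _]/(ext_proj q) q_t0 subrr.
rewrite scale1r => Dx; have : D x + lact x (q : E0).1 = 0 by rewrite addrC.
by move/eqP; rewrite addr_eq0 => /eqP ->; rewrite -[in RHS]scaleN1r lactZr scaleN1r.
Qed.

Lemma lift_JP_surj : {subset ker <= image_sub h JP}.
Proof.
have [|K0|KE e] := minimal_ker (K := image_sub h JP); last by rewrite KE.
  by move=> _ /image_subP[x /lift_JP hx ->].
have [x xJ] := lift_JP_neq0; have : h x \in image_sub h JP by apply/image_subP; exists x.
by rewrite K0 inE => ->.
Qed.

Definition ext_incl (v : S) : env_mod E := (v, 0).

Lemma ext_incl_hom : lie_module_hom ext_incl.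
Proof.
split=> [c v v'|x v].
  exact: ext_inclP.
by rewrite [RHS](ext_in x (ext_incl v)) /ext_act /= scale0r addr0.
Qed.

Lemma ext_incl_inj : injective ext_incl.
Proof. by move=> v v' []. Qed.

Lemma ext_incl_im (e : E) : e \in ker <-> exists v, ext_incl v = e.
Proof.
split=> [|[v <-] ]; last by rewrite [_ \in _]in_ker.
by case: e => v c; rewrite in_ker => /eqP ->; exists v.
Qed.

Let layer := second_Loewy_layer P.

Lemma second_layer_onto_ker : exists phi : {linear layer -> E},
  (forall q, phi q \in ker) /\ forall v, exists q, phi q = ext_incl v.
Proof.
pose phi : {linear layer -> E} := HB.pack (@subquot_map u P E h J2P JP)
  (GRing.isLinear.Build u layer E *:%R _ (subquot_map_linear lift_J2P)).
have phiE x (q : layer) : \val q = \pi_(quotmod J2P) x -> phi q = h x.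
  exact: (subquot_mapE lift_J2P).
exists phi; split=> [q|v].
  by have [x xJ qE] := subquot_surj q; rewrite (phiE x) // lift_JP.
have /lift_JP_surj/image_subP[x xJ vE] : (ext_incl v : E) \in ker.
  by apply/ext_incl_im; exists v.
by have [q qE] := subquot_lift J2P xJ; exists q; rewrite (phiE x).
Qed.

Lemma ker_neq0 : exists2 e : E, e \in ker & e != 0.
Proof.
have [v v_neq0] := S_irreducible.1; exists (ext_incl v : E).
  by apply/ext_incl_im; exists v.
by apply: contraNneq v_neq0 => -[->].
Qed.

Lemma ext_direct_summand : direct_summand S (env_mod layer).
Proof.
have [phi [phi_ker phi_surj] ] := second_layer_onto_ker.
apply: (direct_summand_minimal_quotient (phi := phi) _ minimal_ker ker_neq0 phi_ker
  _ ext_incl_hom ext_incl_inj ext_incl_im).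
  by move=> a q; apply: Jac_second_Loewy_layer.
move=> e /ext_incl_im[v <-]; have [q qE] := phi_surj v.
by apply/image_subP; exists q; rewrite ?in_full_sub.
Qed.

Lemma ext_composition_factor :
  (forall x, exists a : u, x = a *: w) -> composition_factor S P.
Proof.
move=> gen_w.
apply: (composition_factor_preim (h := h) gen_w minimal_ker ker_neq0 _ ext_incl_hom
  ext_incl_inj ext_incl_im).
move=> e /lift_JP_surj/image_subP[x _ ->]; apply/image_subP.
by exists x; rewrite ?in_full_sub.
Qed.

End Extension.

(** * Chief factors *)

Section ChiefFactor.
Variables (F : fieldType) (L : lieAlgType F) (J I : lieIdeal L).
Hypothesis sJI : {subset J <= I}.
Hypothesis minI : minimal_ideal (ideal_image J I).

Local Notation Q := (lie_quot J).
Local Notation S := (chief_factor J I).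
Local Notation piJ := (\pi_(lie_quot J) : L -> Q).

Lemma piJ_bracket (x y : L) : piJ [[x, y]] = [[piJ x, piJ y]].
Proof. exact/esym/quot_bracketE. Qed.

(** Minimality of I / J applied to the ideal spanned by X; bracketing only
    needs to be controlled on the generators. *)
Lemma sub_lie_ideal (X : Q -> Prop) :
    (forall (q : Q) r, X r -> [[q, r]] \in lspan X) ->
    {subset lspan X <= ideal_image J I} ->
  lspan X =i pred1 0 \/ lspan X =i ideal_image J I.
Proof.
move=> X_ideal sXI.
have idealX (q r : Q) : r \in lspan X -> [[q, r]] \in lspan X.
  have inY : forall r : Q, reflect ([[q, r]] \in lspan X)
      (r \in lspan (fun r => [[q, r]] \in lspan X)).
    apply: lspanP => [|a x y xX yX].
      by rewrite -(scale0r (0 : Q)) bracketZr scale0r rpred0.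
    by rewrite bracketDr bracketZr rpredD // rpredZ.
  move=> rX; apply/inY; move: r rX; apply: lspan_min => r Xr.
  by apply/inY; apply: X_ideal.
pose K : lieIdeal Q := HB.pack (lspan X) (isLieIdeal.Build F Q (lspan X) idealX).
by case: minI => _ /(_ K sXI).
Qed.

Lemma chief_factor_neq0 : exists v : S, v != 0.
Proof.
apply: contrapT => no; case: minI => I0 _; apply: I0 => q.
apply/idP/idP => [qI|]; last by rewrite inE => /eqP ->; apply: rpred0.
apply: contrapT => /negP q0; apply: no.
by exists (exist (fun r => r \in ideal_image J I) q qI : S); rewrite -val_eqE.
Qed.

Lemma chief_factor_irreducible : lie_irreducible S.
Proof.
split=> [|K K_stable]; first exact: chief_factor_neq0.
pose X (q : Q) := exists2 v : S, v \in K & \val v = q.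
have inX : forall q, reflect (X q) (q \in lspan X).
  apply: lspanP; first by exists 0; rewrite ?rpred0.
  move=> a _ _ [v vK <-] [w wK <-]; exists (a *: v + w) => //.
  by rewrite rpredD // rpredZ.
have [q _ [v vK <-]|q /inX[v _ <-]|X0|XI] := @sub_lie_ideal X.
- apply/inX; exists (lact (repr q) v); first exact: K_stable.
  by rewrite /= reprK.
- exact: (valP v).
- left=> v; apply/idP/idP => [vK|]; last by rewrite inE => /eqP ->; apply: rpred0.
  have : \val v \in lspan X by apply/inX; exists v.
  by rewrite X0 !inE -val_eqE.
right=> v; have : \val v \in lspan X by rewrite XI; apply: (valP v).
by case/inX => w wK /val_inj <-; rewrite wK.
Qed.

(** The brackets of I / J span an ideal of L / J, by the Jacobi identity. If
    this ideal is all of I / J, then by induction every element of I / J lifts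
    to every term of the derived series of L, so that I / J is zero. *)
Lemma minimal_ideal_abelian : lie_solvable L ->
  forall q r : Q, q \in ideal_image J I -> r \in ideal_image J I -> [[q, r]] = 0.
Proof.
move=> [n solvL].
pose X (z : Q) := exists q r,
  [/\ q \in ideal_image J I, r \in ideal_image J I & z = [[q, r]] ].
have [z _ [q [r [qI rI ->] ] ]|z|X0|XI] := @sub_lie_ideal X.
- have -> : [[z, [[q, r]] ]] = [[ [[z, q]], r]] + [[q, [[z, r]] ]].
    have := jacobi z q r; rewrite (bracketN_anti r z) bracketNr.
    rewrite [ [[r, _]] ]bracketN_anti => /eqP.
    by rewrite subr_eq0 subr_eq addrC => /eqP; rewrite addrC.
  apply: rpredD; apply: lspan_gen.
    by exists [[z, q]], r; split=> //; apply: ideal_bracket.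
  by exists q, [[z, r]]; split=> //; apply: ideal_bracket.
- by apply: lspan_min z => _ [q [r [qI rI ->] ] ]; apply: ideal_bracket.
- move=> q r qI rI; have : [[q, r]] \in lspan X by apply: lspan_gen; exists q, r.
  by rewrite X0 inE => /eqP.
case: minI => [I0 _]; case: I0 => q.
suff lift m : forall q, q \in ideal_image J I -> exists2 x : L, x \in derived m & q = piJ x.
  apply/idP/idP => [/(lift n)[x /solvL]|]; last by rewrite inE => /eqP ->; apply: rpred0.
  by rewrite inE => /eqP -> ->; rewrite raddf0 inE.
elim: m => [|m IHm] {}q; first by exists (repr q); rewrite // reprK.
rewrite -XI => qX.
have inY : forall z : Q, reflect (exists2 x : L, x \in derived m.+1 & z = piJ x)
    (z \in lspan (fun z => exists2 x : L, x \in derived m.+1 & z = piJ x)).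
  apply: lspanP; first by exists 0; rewrite ?rpred0 ?raddf0.
  move=> a _ _ [x xD ->] [y yD ->]; exists (a *: x + y); last by rewrite linearP.
  by apply: rpredD => //; apply: rpredZ.
apply/inY; move: q qX; apply: lspan_min => _ [a [b [aI bI ->] ] ].
have [x xD ->] := IHm a aI; have [y yD ->] := IHm b bI.
apply/inY; exists [[x, y]]; last by rewrite piJ_bracket.
by apply: lspan_gen; exists x, y.
Qed.

Hypothesis abelI : forall q r : Q,
  q \in ideal_image J I -> r \in ideal_image J I -> [[q, r]] = 0.
Hypothesis splitI : split_factor J I.

Lemma lie_quot_mapE x : lie_quot_map I (piJ x) = \pi_(lie_quot I) x.
Proof. by apply/quotmod_eqP/sJI/quotmod_eqP; rewrite reprK. Qed.

Lemma lie_quot_map_ker (q : Q) : lie_quot_map I q = 0 -> q \in ideal_image J I.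
Proof.
rewrite /lie_quot_map -(raddf0 (\pi_(lie_quot I))) => /quotmod_eqP.
by rewrite subr0 => qI; apply/asboolP; exists (repr q); rewrite ?reprK.
Qed.

(** With a and b in the abelian ideal and c and d in the complement, this says
    that the ideal component of a bracket is a derivation. *)
Lemma bracket_complement (a b c d : Q) : [[a, b]] = 0 ->
  [[a + c, b + d]] - [[c, d]] = [[a + c, b]] - [[b + d, a]].
Proof.
move=> ab0; rewrite !bracketDl !bracketDr ab0 (bracketN_anti b a) ab0 oppr0 !add0r.
by rewrite addrA addrK (bracketN_anti d a) opprK addrC.
Qed.

(** D x is the component of x in I / J along the image of the section s. For
    an inner D, take x in I: then D x is the class of x, while x v = 0 because
    I / J is abelian. *)
Lemma split_factor_derivation : exists D : L -> S,
  [/\ linear D, forall x y : L, D [[x, y]] = lact x (D y) - lact y (D x) &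
      forall v : S, ~ forall x : L, D x = lact x v].
Proof.
have [s [lin_s br_s sK] ] := splitI.
pose piI : L -> lie_quot I := \pi_(lie_quot I).
have lin_piI : linear piI by move=> a x y; rewrite /piI linearP.
have lin_piJ : linear piJ by move=> a x y; rewrite linearP.
have br_piI x y : piI [[x, y]] = [[piI x, piI y]] by exact/esym/quot_bracketE.
have memD x : piJ x - s (piI x) \in ideal_image J I.
  apply: lie_quot_map_ker.
  have := sK (piI x); rewrite -{1}[s (piI x)]reprK lie_quot_mapE => sE.
  by rewrite -[s _]reprK -raddfB lie_quot_mapE raddfB /= sE subrr.
pose D x : S := exist (fun q => q \in ideal_image J I) _ (memD x).
exists D; split=> [a x y|x y|v Dv].
- apply: val_inj; rewrite /= lin_piI lin_s lin_piJ scalerBr.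
  by rewrite opprD addrACA.
- apply: val_inj; rewrite /= br_piI br_s piJ_bracket.
  have := bracket_complement (s (piI x)) (s (piI y)) (abelI (memD x) (memD y)).
  by rewrite !subrK.
have [w w_neq0] := chief_factor_neq0; case/negP: w_neq0; apply/eqP/val_inj.
have /asboolP[x xI wE] : \val w \in ideal_image J I := valP w.
have s0 : s 0 = 0 by have := lin_s (-1) 0 0; rewrite scaler0 addr0 scaleN1r addNr.
have piI0 : piI x = 0.
  by rewrite -(raddf0 (\pi_(lie_quot I))); apply/quotmod_eqP; rewrite subr0.
have := congr1 val (Dv x); rewrite /= piI0 s0 subr0 => xE.
rewrite wE -[LHS]/(piJ x) xE abelI //; last exact: (valP v).
by apply/asboolP; exists x.
Qed.

End ChiefFactor.

Lemma chief_factor_restricted (F : fieldType) (p : nat) (L : restrictedLieType F p)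
    (J I : lieIdeal L) (x : L) (v : chief_factor J I) :
  lact (ppow x) v = iter p (lact x) v.
Proof.
have valI n : \val (iter n (lact x) v) = iter n (bracket (\pi_(lie_quot J) x)) (\val v).
  by elim: n => //= n ->.
have piI n y : iter n (bracket (\pi_(lie_quot J) x)) (\pi_(lie_quot J) y) =
               \pi_(lie_quot J) (iter n (bracket x) y).
  by elim: n => //= n ->; rewrite -piJ_bracket.
apply: val_inj; rewrite valI /= -[sval v]reprK piI -ppow_ad.
by rewrite -piJ_bracket.
Qed.

(** * Split chief factors in the projective cover *)

Theorem corollary5p2 (F : fieldType) (p : nat) (charF : p \in [pchar F])
    (L : fdRestrictedLieType F p) (solvL : lie_solvable L)
    (u : restrictedEnvelope L)
    (T : lmodType u) (trivT : lie_module_iso (env_mod T) (trivmod L))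
    (P : lmodType u) (pi : {linear P -> T}) (coverP : projective_cover pi)
    (n : nat) (C : nat -> lieIdeal L) (chiefC : chief_series n C)
    (j : nat) (ltjn : (j < n)%N)
    (splitj : split_factor (C j) (C j.+1)) :
  (~ lie_module_iso (chief_factor (C j) (C j.+1)) (trivmod L) ->
     direct_summand (chief_factor (C j) (C j.+1))
       (env_mod (second_Loewy_layer P))) /\
  composition_factor (chief_factor (C j) (C j.+1)) P.
Proof.
have [projP surj_pi cover_pi] := coverP.
have [tau [lin_tau act_tau] [tau' tauK tau'K] ] := trivT.
pose t0 : T := tau' 1.
have tau_t0 : tau t0 = 1 by rewrite tau'K.
have tau0 : tau 0 = 0 by have := lin_tau (-1) 0 0; rewrite scaler0 addr0 scaleN1r addNr.
have t0_neq0 : t0 != 0.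
  by apply: contraTneq (oner_neq0 F) => t00; rewrite -tau_t0 t00 tau0 eqxx.
have T_line t : exists c : F, t = (c%:A : u) *: t0.
  exists (tau t); apply: (can_inj tauK).
  have := lin_tau (tau t) t0 0; rewrite !addr0 tau0 addr0 tau_t0 => tauE.
  by rewrite -[RHS]/(tau ((tau t : F) *: (t0 : env_mod T))) tauE [RHS]mulr1.
have T_trivial (x : L) (t : T) : env_in u x *: t = 0.
  by apply: (can_inj tauK); rewrite tau0; apply: (act_tau x t).
have [w pi_w] := surj_pi t0.
(* Submodules that map onto T are everything, so w generates P. *)
have gen_w x : exists a : u, x = a *: w.
  suff /(_ x)/orbit_subP[a _ ->] : forall x, x \in orbit_sub (full_sub u^o) w by exists a.
  move=> y; rewrite cover_pi // => z; have [c zE] := T_line (pi z).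
  exists ((c%:A : u) *: w), (z - (c%:A : u) *: w); split.
  - by apply/orbit_subP; exists (c%:A : u) => //; exact: in_full_sub.
  - by rewrite linearB linearZ /= pi_w zE subrr.
  by rewrite addrC subrK.
have [_ _ /(_ j ltjn)[sCj minCj] ] := chiefC.
have S_irr := chief_factor_irreducible minCj.
have [trivS|nontrivS] :=
  pselect (lie_module_iso (chief_factor (C j) (C j.+1)) (trivmod L)).
  split=> //; have [f [lin_f act_f] [f' fK f'K] ] := trivS.
  apply: (composition_factor_preim (h := pi) (N := full_sub T) (iota := tau' \o f)) => //.
  - exact: minimal_trivial T_line.
  - by exists t0; rewrite ?in_full_sub.
  - move=> t _; have [x <-] := surj_pi t.
    by apply/image_subP; exists x; rewrite ?in_full_sub.
  - split=> [a v v'|x v] /=; apply: (can_inj tauK).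
      by rewrite lin_tau !tau'K lin_f.
    by rewrite act_tau !tau'K act_f.
  - by apply: inj_comp; [exact: can_inj tau'K | exact: can_inj fK].
  move=> t; split=> _; last exact: in_full_sub.
  by exists (f' (tau t)); rewrite /= f'K tauK.
have [D [D_lin D_der D_out] ] :=
  split_factor_derivation sCj minCj (minimal_ideal_abelian minCj solvL) splitj.
have S_inv := irreducible_invariants S_irr nontrivS.
have [g g_in _] := env_universal u
  (ext_rep_morphism charF (@chief_factor_restricted _ _ _ _ _) S_inv D_lin D_der).
have [h h_pi] := ext_lift g_in pi T_line T_trivial projP.
split=> [_|].
  exact: (ext_direct_summand S_irr D_out g_in t0_neq0 T_line T_trivial h_pi pi_w).
exact: (ext_composition_factor S_irr D_out g_in t0_neq0 T_line T_trivial h_pi pi_w).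
Qed.
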